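(* Let $\varphi:\mathbb{P}^N\dashrightarrow\mathbb{P}^N$ be a dominant rational map of degree $d\ge2$ defined over $\overline{\mathbb{Q}}$, and let $P\in\mathbb{P}^N(\overline{\mathbb{Q}})_\varphi$. Then $$\alpha_\varphi(P)\le\delta_\varphi.$$
   Context: For a dominant rational map $\varphi:\mathbb{P}^N\dashrightarrow\mathbb{P}^N$, $\deg\varphi$ is the common degree of homogeneous polynomials without common factor defining $\varphi$, and the dynamical degree is $\delta_\varphi=\lim_{n\to\infty}(\deg\varphi^n)^{1/n}$ (the limit exists), where $\varphi^n$ is the $n$-th iterate. $Z(\varphi)$ is the indeterminacy locus, $\mathcal{O}_\varphi(P)=\{\varphi^n(P):n\ge0\}$, and $\mathbb{P}^N(\overline{\mathbb{Q}})_\varphi=\{P\in\mathbb{P}^N(\overline{\mathbb{Q}}):\mathcal{O}_\varphi(P)\cap Z(\varphi)=\emptyset\}$. Let $h:\mathbb{P}^N(\overline{\mathbb{Q}})\to[0,\infty)$ be the absolute logarithmic Weil height. The arithmetic degree is $\alpha_\varphi(P)=\limsup_{n\to\infty}h(\varphi^n(P))^{1/n}$, with the convention $\alpha_\varphi(P)=1$ if $h(\varphi^n(P))=0$ for all sufficiently large $n$. *)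

(* Defs.v *)
(* Qbar is [algC]; the real numbers are an arbitrary [R : realType]. *)
From mathcomp Require Import all_boot all_order all_algebra all_field.
From mathcomp Require Import generic_quotient finmap mpoly.
From mathcomp Require Import all_classical all_reals.
From mathcomp Require Import topology normedtype sequences exp.

Set Implicit Arguments.
Unset Strict Implicit.
Unset Printing Implicit Defensive.

Import Order.TTheory GRing.Theory Num.Theory.
Import numFieldNormedType.Exports.

Local Open Scope classical_set_scope.
Local Open Scope ring_scope.
Local Open Scope quotient_scope.

(** * Projective space over Qbar *)

Definition hcoord (N : nat) := {x : 'rV[algC]_N.+1 | x != 0}.

Definition proportional (N : nat) (x y : hcoord N) : bool :=
  `[< exists c : algC, c != 0 /\ val y = c *: val x >].

Fact proportional_refl N : reflexive (@proportional N).
Proof. by move=> x; apply/asboolP; exists 1; rewrite oner_eq0 scale1r. Qed.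

Fact proportional_sym N : ssrbool.symmetric (@proportional N).
Proof.
suff H (x y : hcoord N) : proportional x y -> proportional y x.
  by move=> x y; apply/idP/idP; exact: H.
move=> /asboolP[c [c0 yE]]; apply/asboolP; exists c^-1.
by rewrite invr_eq0 yE scalerA mulVf // scale1r.
Qed.

Fact proportional_trans N : transitive (@proportional N).
Proof.
move=> y x z /asboolP[c [c0 yE]] /asboolP[d [d0 zE]]; apply/asboolP.
by exists (d * c); rewrite mulf_neq0 // zE yE scalerA.
Qed.

Canonical proportional_equiv (N : nat) :=
  EquivRel (@proportional N) (@proportional_refl N)
    (@proportional_sym N) (@proportional_trans N).

Definition proj_space (N : nat) := {eq_quot @proportional N}.

(* Homogeneous coordinates of a point; they are only canonical up to a nonzero
   scalar. *)
Definition coords (N : nat) (P : proj_space N) : 'rV[algC]_N.+1 :=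
  val (repr P).

(** * Rational self-maps of projective space *)

Definition forms (N : nat) := N.+1.-tuple {mpoly algC[N.+1]}.

Definition homogeneous (N : nat) (F : forms N) (d : nat) : Prop :=
  forall i, tnth F i \is ishomog1 d mdeg.

(* Zero divides only zero, and everything divides zero, so this excludes the
   zero tuple. *)
Definition no_common_factor (N : nat) (F : forms N) : Prop :=
  forall g : {mpoly algC[N.+1]},
    (forall i, exists q, tnth F i = q * g) ->
    exists c : algC, c != 0 /\ g = c%:MP.

(* A rational map is given by its forms without common factor, which are unique
   up to a common nonzero scalar. *)
Record ratmap (N : nat) := RatMap {
  ratmap_forms :> forms N;
  ratmap_deg : nat;
  ratmap_homogeneous : homogeneous ratmap_forms ratmap_deg;
  ratmap_reduced : no_common_factor ratmap_forms }.

Definition eval_forms (N : nat) (F : forms N) (x : 'rV[algC]_N.+1) :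
    'rV[algC]_N.+1 :=
  \row_i (tnth F i).@[fun j => x 0 j].

Definition indeterminacy (N : nat) (phi : ratmap N) : set (proj_space N) :=
  [set P | eval_forms phi (coords P) = 0].

(* Outside the indeterminacy locus this is the value of phi; on it the value is
   the irrelevant default P. *)
Definition ratmap_apply (N : nat) (phi : ratmap N) (P : proj_space N) :
    proj_space N :=
  \pi_(proj_space N) (insubd (repr P) (eval_forms phi (coords P))).

Definition orbit_defined (N : nat) (phi : ratmap N) (P : proj_space N) : Prop :=
  forall n, ~ indeterminacy phi (iter n (ratmap_apply phi) P).

(* The image is Zariski dense: the only form vanishing on it is zero. *)
Definition dominant (N : nat) (phi : ratmap N) : Prop :=
  forall (e : nat) (Q : {mpoly algC[N.+1]}), Q \is ishomog1 e mdeg ->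
    (forall P, ~ indeterminacy phi P ->
       Q.@[fun j => coords (ratmap_apply phi P) 0 j] = 0) ->
    Q = 0.

(** * Degrees of iterates and the dynamical degree *)

(* For nonzero tuples: F and G define the same rational map. *)
Definition same_map (N : nat) (F G : forms N) : Prop :=
  forall i j, tnth F i * tnth G j = tnth F j * tnth G i.

Definition comp_forms (N : nat) (F G : forms N) : forms N :=
  [tuple tnth F i \mPo G | i < N.+1].

(* The n-fold substitution of F into itself; it represents the n-th iterate but
   may have a common factor. *)
Definition iter_forms (N : nat) (F : forms N) (n : nat) : forms N :=
  iter n (comp_forms F) [tuple 'X_i | i < N.+1].

(* The degree of the n-th iterate: that of forms without common factor defining
   it.  For a dominant map exactly one d qualifies. *)
Definition iterate_deg (N : nat) (phi : ratmap N) (n : nat) : nat :=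
  xget 0%N [set d | exists psi : ratmap N,
    same_map psi (iter_forms phi n) /\ ratmap_deg psi = d].

Definition dynamical_degree (R : realType) (N : nat) (phi : ratmap N) : R :=
  limn (fun n => (iterate_deg phi n)%:R `^ n%:R^-1).

(** * The absolute logarithmic Weil height *)

(* The places of Q: [None] is the archimedean one. *)
Definition placeQ : Type := option {p : nat | prime p}.

Definition absQ (R : realType) (v : placeQ) (q : rat) : R :=
  match v with
  | None => `| ratr q |
  | Some p => if q == 0 then 0 else
      (val p)%:R ^ ((logn (val p) `|denq q|%N)%:Z - (logn (val p) `|numq q|%N)%:Z)
  end.

(* A choice, for every place v of Q, of an extension of |.|_v to Qbar. *)
Record absQbar (R : realType) := AbsQbar {
  absv :> placeQ -> algC -> R;
  absv_ge0 : forall v x, 0 <= absv v x;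
  absv_eq0 : forall v x, absv v x = 0 -> x = 0;
  absvM : forall v x y, absv v (x * y) = absv v x * absv v y;
  absvD : forall v x y, absv v (x + y) <= absv v x + absv v y;
  absv_ratr : forall v q, absv v (ratr q) = absQ R v q }.

Definition conjugates (n : nat) (x : 'rV[algC]_n) : set 'rV[algC]_n :=
  [set y | exists sigma : {rmorphism algC -> algC}, y = map_mx sigma x].

(* Let x be homogeneous coordinates of P and K = Q(x_0, ..., x_N).  The
   conjugates y of x are the sigma(x) for sigma : K -> Qbar, so there are [K:Q]
   of them.  Each place w of K above a place v of Q is induced, through
   a |-> |sigma(a)|_v, by exactly [K_w:Q_v] embeddings sigma.  Hence this is
     (1/[K:Q]) sum_(w in M_K) [K_w:Q_w] log max_i |x_i|_w.
   The set of conjugates and the support of the sum over v are finite. *)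
Definition weil_height (R : realType) (abs : absQbar R) (N : nat)
    (P : proj_space N) : R :=
  let conj := conjugates (coords P) in
  (#|` fset_set conj|%:R)^-1 *
  \sum_(v \in [set: placeQ]) \sum_(y \in conj)
     ln (\big[Num.max/0]_(i < N.+1) abs v (y 0 i)).

(** * The arithmetic degree *)

(* The limsup is taken in \bar R: its finiteness is not known beforehand. *)
Definition arithmetic_degree (R : realType) (abs : absQbar R) (N : nat)
    (phi : ratmap N) (P : proj_space N) : \bar R :=
  let h n := weil_height abs (iter n (ratmap_apply phi) P) in
  if `[< exists m, forall n, (m <= n)%N -> h n = 0 >] then 1%E
  else limn_esup (fun n => (h n `^ n%:R^-1)%:E).

(* Main.v *)
From HB Require Import structures.
Require Import Defs.
From mathcomp Require Import all_boot all_order all_algebra all_field.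
From mathcomp Require Import generic_quotient finmap mpoly.
From mathcomp Require Import all_classical all_reals.
From mathcomp Require Import ereal topology normedtype sequences exp.
From mathcomp Require Import ring zify.

(* Let psi_m be the reduced form of the m-th iterate and d_m its degree. The
   m-fold substitution of phi into itself is a polynomial multiple of psi_m,
   because polynomial rings are factorial; hence psi_m is defined along the orbit
   of P, and d_(m+n) <= d_m d_n. For a form of degree d the height satisfies
   h(psi x) <= d h(x) + C: at each place a monomial of degree d is at most the
   d-th power of the maximal coordinate, the coefficients contribute at finitely
   many places only, and the scalar between the two choices of coordinates drops
   out by the product formula. So h(phi^(n+m) P) <= d_m h(phi^n P) + C_m, and the
   upper growth rate of the heights is at most d_m^(1/m) for every m >= 1. By
   Fekete's lemma these roots converge to their infimum, the dynamical degree. *)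

Set Implicit Arguments.
Unset Strict Implicit.
Unset Printing Implicit Defensive.

Import Order.TTheory GRing.Theory Num.Theory.
Import numFieldNormedType.Exports.

Local Open Scope classical_set_scope.
Local Open Scope ring_scope.
Local Open Scope quotient_scope.

(** * Factoriality of polynomial rings *)

(** Applying the height inequality to [phi] itself only bounds the growth by the degree of [phi];
    the common factors lost under iteration are what separates that from the dynamical degree, so
    the inequality is needed for the reduced forms. These must not vanish at the points of the
    orbit: there the coordinates of the iterate are a scalar times the removed factor times the
    reduced forms, and they are nonzero, so both factors are. The constant of the inequality grows
    with m in an uncontrolled way, which is harmless because m is fixed before n tends to infinity;
    it must only be the same for all points of the orbit. No number field is ever fixed. Heights are
    averages over conjugate vectors, and the conjugates of a point, of its image and of the scalar
    linking them are different sets. They are compared through the conjugates of the concatenation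
    of the three vectors. *)

Section Divisibility.
Variable A : idomainType.
Implicit Types x y z : A.

Definition divides (x y : A) := exists q, y = q * x.

Definition prime_elt (x : A) :=
  [/\ x != 0, x \isn't a GRing.unit &
      forall y z : A, divides x (y * z) -> divides x y \/ divides x z].

Definition factorizable (x : A) :=
  exists u s, [/\ u \is a GRing.unit, (forall y, y \in s -> prime_elt y) &
                  x = u * \prod_(y <- s) y].

(** Existence is enough: the factors are prime and not merely irreducible, so uniqueness follows. *)
Definition ufd := forall x : A, x != 0 -> factorizable x.

Lemma factorizableM (x y : A) :
  factorizable x -> factorizable y -> factorizable (x * y).
Proof.
move=> [u [s [uU sP ->]]] [v [t [vU tP ->]]].
exists (u * v), (s ++ t); split; first by rewrite unitrM uU.
  by move=> z; rewrite mem_cat => /orP[/sP|/tP].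
by rewrite big_cat /= mulrACA.
Qed.

Lemma factorizable_prime (x : A) :
  prime_elt x -> factorizable x.
Proof.
move=> xP; exists 1, [:: x]; split; rewrite ?unitr1 ?big_seq1 ?mul1r //.
by move=> y; rewrite inE => /eqP ->.
Qed.

Lemma dividesDl (x y z : A) :
  divides x z -> divides x (y + z) -> divides x y.
Proof. by move=> [q ->] [r rE]; exists (r - q); rewrite mulrBl -rE addrK. Qed.

Lemma divides_mull (x y z : A) :
  divides x z -> divides x (y * z).
Proof. by move=> [q ->]; exists (y * q); rewrite mulrA. Qed.

Lemma prime_elt_assoc (x y : A) :
  prime_elt x -> prime_elt y -> divides x y ->
  exists2 w, w \is a GRing.unit & y = w * x.
Proof.
move=> [x0 xU _] [y0 yU yP] [w yE]; exists w => //.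
have : divides y (w * x) by exists 1; rewrite mul1r yE.
case/yP => -[v vE]; last first.
  have /eqP : (v * w - 1) * x = 0 by rewrite mulrBl mul1r -mulrA -yE -vE subrr.
  rewrite mulf_eq0 (negPf x0) orbF subr_eq0 => /eqP vw.
  by apply/unitrPr; exists v; rewrite mulrC.
have w0 : w != 0 by apply: contra_neq y0 => w0; rewrite yE w0 mul0r.
case/negP: xU.
have /eqP : (v * x - 1) * w = 0.
  by rewrite mulrBl mul1r -mulrA [x * w]mulrC -yE -vE subrr.
rewrite mulf_eq0 (negPf w0) orbF subr_eq0 => /eqP vx.
by apply/unitrPr; exists v; rewrite mulrC.
Qed.

End Divisibility.

(** * Gauss: factoriality passes to univariate polynomials *)

Section Gauss.
Variable R : idomainType.
Implicit Types (c p : R) (s : seq R) (f g : {poly R}).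

Lemma divides_polyC p f :
  divides p%:P f <-> forall i, divides p f`_i.
Proof.
split=> [[q ->] i|pf]; first by exists q`_i; rewrite coefMC.
have /choice[q qE] : forall i, exists q, f`_i = q * p by exact: pf.
exists (\poly_(i < size f) q i); apply/polyP => i.
rewrite coefMC coef_poly; case: ltnP => [_|szi]; first by rewrite -qE.
by rewrite mul0r nth_default.
Qed.

Lemma divides_polyC_MXaddC p f c :
  divides p%:P (f * 'X + c%:P) <-> divides p%:P f /\ divides p c.
Proof.
rewrite !divides_polyC; split=> [pf|[pf pc] i].
  split=> [i|].
    by have := pf i.+1; rewrite coefD coefMX coefC /= addr0.
  by have := pf 0%N; rewrite coefD coefMX coefC /= add0r.
by rewrite coefD coefMX coefC; case: i => [|i] /=; rewrite ?add0r ?addr0.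
Qed.

Lemma prime_elt_polyC p : prime_elt p -> prime_elt p%:P.
Proof.
move=> [p0 pU pP]; split; first by rewrite polyC_eq0.
  by rewrite poly_unitE size_polyC p0 /= coefC.
elim/poly_ind => [|f c IHf] g; first by left; exists 0; rewrite mul0r.
elim/poly_ind: g => [|g d IHg] pfg; first by right; exists 0; rewrite mul0r.
have pcd : divides p (c * d).
  have := (divides_polyC p _).1 pfg 0%N.
  by rewrite coef0M !coefD !coefMX !coefC /= !add0r.
have [pc|pd] := pP _ _ pcd.
  have pcP : divides p%:P c%:P.
    by case: pc => q ->; exists q%:P; rewrite polyCM.
  have : divides p%:P (f * 'X * (g * 'X + d%:P)).
    apply: (dividesDl (z := c%:P * (g * 'X + d%:P))); last by rewrite -mulrDl.
    by rewrite mulrC; apply: divides_mull.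
  rewrite mulrAC -[X in divides _ X]addr0 -polyC0 => /divides_polyC_MXaddC[pfg' _].
  have [pf|] := IHf _ pfg'; last by right.
  by left; apply/divides_polyC_MXaddC.
have pdP : divides p%:P d%:P.
  by case: pd => q ->; exists q%:P; rewrite polyCM.
have : divides p%:P ((f * 'X + c%:P) * (g * 'X)).
  apply: (dividesDl (z := (f * 'X + c%:P) * d%:P)); last by rewrite -mulrDr.
  exact: divides_mull.
rewrite mulrA -[X in divides _ X]addr0 -polyC0 => /divides_polyC_MXaddC[pfg' _].
have [|pg] := IHg pfg'; first by left.
by right; apply/divides_polyC_MXaddC.
Qed.

Lemma scaler_polyC_inj p f g : p != 0 -> p *: f = g * p%:P -> f = g.
Proof.
by move=> p0; rewrite -mul_polyC mulrC => /mulIf; apply; rewrite polyC_eq0.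
Qed.

(* Clearing a denominator, one prime factor at a time. *)
Lemma clear_denominator c f q g : ufd R -> c != 0 ->
  c *: f = q * g ->
  exists q' g', [/\ f = q' * g', size q' = size q & size g' = size g].
Proof.
move=> ufdR /ufdR[u [s [uU sP ->]]].
elim: s q g sP => [|p s IHs] q g sP.
  rewrite big_nil mulr1 => fE; exists (u^-1 *: q), g; split=> //.
    by rewrite -scalerAl -fE scalerA mulVr // scale1r.
  by rewrite size_scale // invr_neq0 //; apply: contraTneq uU => ->; rewrite unitr0.
have pP : prime_elt p by apply: sP; rewrite mem_head.
have p0 : p != 0 by case: pP.
have {}sP y : y \in s -> prime_elt y by move=> ys; apply: sP; rewrite inE ys orbT.
rewrite big_cons mulrCA -scalerA => fE.
have [_ _ /(_ q g)] := prime_elt_polyC pP.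
case; first by exists ((u * \prod_(y <- s) y) *: f); rewrite -fE -mul_polyC mulrC.
  move=> [r rE]; move: fE; rewrite rE mulrAC => /(scaler_polyC_inj p0) /IHs -/(_ sP).
  move=> [q' [g' [-> szq szg]]]; exists q', g'; split=> //.
  by rewrite szq mulrC mul_polyC size_scale.
move=> [r rE]; move: fE; rewrite rE mulrA => /(scaler_polyC_inj p0) /IHs -/(_ sP).
move=> [q' [g' [-> szq szg]]]; exists q', g'; split=> //.
by rewrite szg mulrC mul_polyC size_scale.
Qed.

(** Since [f] is primitive, every prime factor of [c] divides the cofactor and cancels. So
    divisibility over the fraction field descends to [R]. *)
Lemma divides_of_scale c f (a : {poly R}) : ufd R -> c != 0 ->
    (forall p, prime_elt p -> ~ divides p%:P f) ->
  divides f (c *: a) -> divides f a.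
Proof.
move=> ufdR /ufdR[u [s [uU sP ->]]] fprim.
elim: s sP => [|p s IHs] sP [q].
  rewrite big_nil mulr1 => fE; exists (u^-1 *: q).
  by rewrite -scalerAl -fE scalerA mulVr // scale1r.
have pP : prime_elt p by apply: sP; rewrite mem_head.
have p0 : p != 0 by case: pP.
rewrite big_cons mulrCA -scalerA => fE; apply: IHs.
  by move=> y ys; apply: sP; rewrite inE ys orbT.
have [_ _ /(_ q f)] := prime_elt_polyC pP.
case; last by move/(fprim _ pP).
  by exists ((u * \prod_(y <- s) y) *: a); rewrite -fE -mul_polyC mulrC.
move=> [r rE]; exists r; move: fE; rewrite rE mulrAC [RHS]mulrC mul_polyC.
by rewrite -!mul_polyC => /mulfI; apply; rewrite polyC_eq0.
Qed.


(** The relation [%|] is divisibility up to a nonzero scalar, that is, over the fraction field,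
    where Euclid's lemma is available. [clear_denominator] shows that [f] stays irreducible there,
    and [divides_of_scale] brings the conclusion back. *)
Lemma prime_elt_irreducible f : ufd R -> (1 < size f)%N ->
    (forall p, prime_elt p -> ~ divides p%:P f) ->
    (forall g h, f = g * h -> (size g <= 1)%N \/ (size h <= 1)%N) ->
  prime_elt f.
Proof.
move=> ufdR szf fprim fsplit.
have f0 : f != 0 by rewrite -size_poly_gt0 ltnW.
have firr : irreducible_poly f.
  split=> // q szq /Pdiv.Idomain.dvdpP[[c r] /= c0 fqE].
  have qdiv : q %| f by apply/Pdiv.Idomain.dvdpP; exists (c, r).
  move: fqE => /(clear_denominator ufdR c0).
  move=> [r' [q' [fE szr' szq']]].
  have := f0; rewrite {1}fE mulf_eq0 negb_or => /andP[r0 q0].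
  rewrite -dvdp_size_eqp // fE size_mul //.
  have := r0; have := q0; rewrite -!size_poly_gt0 szq' szr'.
  have := fsplit _ _ fE; rewrite szq' szr'.
  case=> [|szq1 q1]; first by case: (size r) => [|[]].
  by move: szq szq1 q1; case: (size q) => [|[]].
split=> // [|y z [q yzE]]; first by rewrite poly_unitE eqn_leq leqNgt szf.
have fyz : f %| y * z by rewrite yzE dvdp_mull.
have fdiv (a : {poly R}) : f %| a -> divides f a.
  move=> /Pdiv.Idomain.dvdpP[[c r] /= c0 aE].
  by apply: (divides_of_scale ufdR c0 fprim); exists r.
have [cop|ncop] := boolP (coprimep f y).
  by right; apply: fdiv; rewrite -(Gauss_dvdpr _ cop).
left; apply: fdiv.
have := firr.2 _ ncop (dvdp_gcdl f y).
by move=> /andP[_ /dvdp_trans]; apply; exact: dvdp_gcdr.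
Qed.

Lemma prime_elt_dvd_prod (u : R) s p : prime_elt p -> u \is a GRing.unit ->
  divides p (u * \prod_(y <- s) y) -> exists2 y, y \in s & divides p y.
Proof.
move=> [p0 pU pP] uU; elim: s => [|y s IHs].
  rewrite big_nil mulr1 => -[q uE]; case/negP: pU.
  by move: uU; rewrite uE unitrM => /andP[].
rewrite big_cons mulrCA => /pP[py|/IHs[z zs pz]].
  by exists y; rewrite ?mem_head.
by exists z; rewrite // inE zs orbT.
Qed.

(** The outer induction, on the size, serves proper splittings. The inner one, on the number of
    primes in the leading coefficient, strips the content: a prime constant dividing [f] divides its
    leading coefficient, and dividing it out removes one prime there. *)
Lemma ufd_poly : ufd R -> ufd {poly R}.
Proof.
move=> ufdR f; have [n] := ubnP (size f); elim: n f => // n IHn f szf f0.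
have [u [s [uU sP lfE]]] : factorizable (lead_coef f).
  by apply: ufdR; rewrite lead_coef_eq0.
have [k] := ubnP (size s).
elim: k f szf f0 u s uU sP lfE => // k IHk f szf f0 u s uU sP lfE szs.
have [[p pP [q fE]]|fprim] :=
    pselect (exists2 p : R, prime_elt p & divides p%:P f).
  have p0 : p != 0 by case: pP.
  rewrite fE; apply: factorizableM; last first.
    exact/factorizable_prime/prime_elt_polyC.
  have lqE : lead_coef f = lead_coef q * p by rewrite fE lead_coefM lead_coefC.
  have [y ys py] : exists2 y, y \in s & divides p y.
    by apply: (prime_elt_dvd_prod pP uU); rewrite -lfE; exists (lead_coef q).
  have [w wU yE] := prime_elt_assoc pP (sP _ ys) py.
  apply: (IHk q _ _ (u * w) (rem y s)).
  - by move: szf; rewrite fE mulrC mul_polyC size_scale.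
  - by apply: contra_neq f0 => q0; rewrite fE q0 mul0r.
  - by rewrite unitrM uU.
  - by move=> z /mem_rem; exact: sP.
  - apply: (mulIf p0); rewrite -lqE lfE (perm_big _ (perm_to_rem ys)) big_cons /=.
    by rewrite {1}yE -!mulrA; congr (u * (w * _)); rewrite mulrC.
  - by rewrite size_rem //; move: szs ys; case: (s).
have {}fprim p : prime_elt p -> ~ divides p%:P f.
  by move=> pP pf; apply: fprim; exists p.
have [szf1|szf1] := leqP (size f) 1.
  have fE : f = (lead_coef f)%:P.
    rewrite lead_coefE (eqP (_ : (size f).-1 == 0%N)); last first.
      by move: szf1; case: (size f) => [|[]].
    exact: size1_polyC.
  exists u%:P, [seq y%:P | y <- s]; split.
  - rewrite poly_unitE coefC eqxx size_polyC uU andbT eqb1.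
    by apply: contraTneq uU => ->; rewrite unitr0.
  - by move=> _ /mapP[y ys ->]; exact/prime_elt_polyC/sP.
  - by rewrite fE lfE polyCM big_map -rmorph_prod.
have [[g [h [fE szg szh]]]|fsplit] := pselect (exists g h,
    [/\ f = g * h, (1 < size g)%N & (1 < size h)%N]).
  have := f0; rewrite {1}fE mulf_eq0 negb_or => /andP[g0 h0].
  have := szf; rewrite fE size_mul // ltnS => szgh.
  apply: factorizableM; apply: IHn => //; lia.
apply/factorizable_prime/prime_elt_irreducible => // g h fE.
have [|szg] := leqP (size g) 1; first by left.
have [|szh] := leqP (size h) 1; first by right.
by case: fsplit; exists g, h.
Qed.
End Gauss.

Lemma ufd_iso (A B : idomainType) (f : {rmorphism A -> B}) (g : {rmorphism B -> A}) :
  cancel f g -> cancel g f -> ufd B -> ufd A.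
Proof.
move=> fK gK ufdB x x0.
have [|u [s [uU sP fxE]]] := ufdB (f x).
  by rewrite -(rmorph0 f) (inj_eq (can_inj fK)).
exists (g u), [seq g y | y <- s]; split.
- exact: (rmorph_unit g).
- move=> _ /mapP[y /sP[y0 yU yP] ->]; split.
  + by rewrite -(rmorph0 g) (inj_eq (can_inj gK)).
  + by apply: contra yU => /(rmorph_unit f); rewrite gK.
  + move=> a b [q abE].
    have [] := yP (f a) (f b).
    * by exists (f q); rewrite -rmorphM abE rmorphM gK.
    * by case=> r rE; left; exists (g r); rewrite -rmorphM -rE fK.
    * by case=> r rE; right; exists (g r); rewrite -rmorphM -rE fK.
- by rewrite big_map -rmorph_prod -rmorphM -fxE fK.
Qed.

(** * Factoriality in several variables *)

Section MultivariateFactoriality.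
Variable K : fieldType.

(** The inverse of [muni], which singles out the last variable. *)
Definition of_muni n (q : {poly {mpoly K[n]}}) : {mpoly K[n.+1]} :=
  (map_poly (@mwiden n K) q).['X_ord_max].

Fact of_muni_is_zmod n : zmod_morphism (@of_muni n).
Proof. by move=> p q; rewrite /of_muni rmorphB hornerD hornerN. Qed.

Fact of_muni_is_monoid n : monoid_morphism (@of_muni n).
Proof.
by split=> [|p q]; rewrite /of_muni ?rmorph1 ?hornerC // rmorphM hornerM.
Qed.

HB.instance Definition _ n :=
  GRing.isZmodMorphism.Build _ _ (@of_muni n) (@of_muni_is_zmod n).
HB.instance Definition _ n :=
  GRing.isMonoidMorphism.Build _ _ (@of_muni n) (@of_muni_is_monoid n).

Lemma muniK n : cancel (@muni n K) (@of_muni n).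
Proof.
move=> p; rewrite muniE (rmorph_sum (@of_muni n)) [RHS]mpolyE.
apply: eq_bigr => m _ /=.
rewrite /of_muni -mul_polyC rmorphM /= map_polyC map_polyXn hornerM hornerC hornerXn.
rewrite [X in X * _]mwidenZ mwidenX -scalerAl; congr (_ *: _).
rewrite mpolyXn -mpolyXD; congr 'X_[_]; apply/mnmP => i.
rewrite mnmDE mulmnE mnm1E.
have [j ->|->] := unliftP ord_max i.
  rewrite (_ : lift ord_max j = widen_ord (leqnSn n) j).
    rewrite mnmwiden_widen mnmE.
    by rewrite eq_sym (_ : _ == _ = false) ?muln0 ?addn0 // -val_eqE /= ltn_eqF.
  exact/val_inj/lift_max.
by rewrite mnmwiden_ordmax eqxx mul1n.
Qed.

Lemma of_muniK n : cancel (@of_muni n) (@muni n K).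
Proof.
have muniX (m : 'X_{1..n.+1}) : muni 'X_[K, m] =
    'X_[[multinom m (widen_ord (leqnSn n) i) | i < n]] *: 'X^(m ord_max).
  by rewrite muniE msuppX big_seq1 mcoeffX eqxx scale1r.
have muni_widen (q : {mpoly K[n]}) : muni (mwiden q) = q%:P.
  rewrite [q]mpolyE (rmorph_sum (@mwiden n K)) (rmorph_sum (@muni n K)).
  rewrite (rmorph_sum polyC); apply: eq_bigr => m _.
  rewrite /= mwidenZ muniZ mwidenX muniX mnmwiden_ordmax expr0 -mul_mpolyC.
  rewrite -!mul_polyC mulr1 -polyCM; congr (_ * 'X_[_])%:P.
  by apply/mnmP => i; rewrite mnmE mnmwiden_widen.
elim/poly_ind => [|q c IHq]; first by rewrite !rmorph0.
rewrite rmorphD rmorphM /= rmorphD rmorphM /= IHq; congr (_ * _ + _).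
  rewrite /of_muni map_polyX hornerX muniX mnm1E eqxx expr1.
  rewrite (_ : [multinom _ | i < n] = 0%MM) ?mpolyX0 ?scale1r //.
  by apply/mnmP => i; rewrite mnmE mnm1E mnm0E -val_eqE /= gtn_eqF.
by rewrite /of_muni map_polyC hornerC muni_widen.
Qed.

Lemma ufd_mpoly n : ufd {mpoly K[n]}.
Proof.
elim: n => [|n IHn]; last exact: ufd_iso (@muniK n) (@of_muniK n) (ufd_poly IHn).
move=> x x0; exists x, [::]; split; rewrite ?big_nil ?mulr1 //.
have xE := nvar0_mpolyC x; apply/unitrPr; exists (x@_0%MM)^-1%:MP.
rewrite {1}xE -mpolyCM mulfV ?mpolyC1 //.
by apply: contra_neq x0 => x0; rewrite xE x0.
Qed.

(* [f] has no common factor, so no prime dividing [f i0] divides all the [f i]. *)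
Lemma proportional_to_coprime n (I : Type) (f g : I -> {mpoly K[n]}) (i0 : I) :
  f i0 != 0 ->
  (forall p, (forall i, divides p (f i)) -> p \is a GRing.unit) ->
  (forall i j, f i * g j = f j * g i) ->
  exists h, forall i, g i = h * f i.
Proof.
move=> f0 fcop fg.
suff [h hE] : divides (f i0) (g i0).
  exists h => i; apply: (mulfI f0); rewrite fg hE; rewrite mulrCA mulrA.
  by rewrite mulrC.
(* This consequence of the cross relations is the invariant of the induction: it survives dividing
   [f i0] and [g i0] by the same prime. *)
have : forall i, divides (f i0) (g i0 * f i).
  by move=> i; exists (g i); rewrite mulrC -fg mulrC.
have [u [s [uU sP ->]]] := ufd_mpoly f0.
elim: s sP (g i0) => [|p s IHs] sP a.
  by move=> _; exists (a / u); rewrite big_nil mulr1 divrK.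
rewrite big_cons mulrCA => pa.
have [p0 pU pP] : prime_elt p by apply: sP; rewrite mem_head.
have pdiv i : divides p (a * f i).
  have [q ->] := pa i; exists (q * (u * \prod_(y <- s) y)).
  by ring.
have [[a' aE]|npa] := pselect (divides p a).
  have [|i|q qE] := IHs _ a'.
  - by move=> y ys; apply: sP; rewrite inE ys orbT.
  - have [q qE] := pa i; exists q; apply: (mulIf p0).
    by rewrite mulrAC -aE qE; ring.
  - by exists q; rewrite aE qE; ring.
case/negP: pU; apply: fcop => i.
by have [] := pP _ _ (pdiv i).
Qed.
End MultivariateFactoriality.

(** * Homogeneous polynomials *)

Section Homogeneity.
Variables (K : fieldType) (n : nat).
Implicit Types f g : {mpoly K[n]}.

(** The smallest monomial of a product arises from one pair only, so nothing cancels; the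
    counterpart of the rule for leading monomials. *)
Lemma mcoeff_mlastM f g : f != 0 -> g != 0 ->
  (f * g)@_(mlast f + mlast g) = f@_(mlast f) * g@_(mlast g).
Proof.
move=> f0 g0; rewrite mpolyME (bigD1_seq (mlast f, mlast g)) /=; first last.
- by rewrite allpairs_uniq // => -[? ?] [].
- by rewrite allpairs_f ?mlast_supp.
rewrite mcoeffD mcoeffZ mcoeffX eqxx mulr1.
rewrite big_seq_cond raddf_sum /= big1 ?addr0 // => -[m1 m2] /andP[/allpairsP[[? ?] /=]].
move=> [m1f m2g [-> ->]] ne; rewrite mcoeffZ mcoeffX.
have [/eqP mE|] := boolP (_ == _); last by rewrite mulr0.
case/negP: ne; have := mlast_lemc m1f; have := mlast_lemc m2g.
rewrite le_eqVlt => /predU1P[m2E|lt2] le1.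
  by move/eqP: mE; rewrite -m2E eqm_add2r => /eqP ->.
by have := lemc_lt_add le1 lt2; rewrite mE ltxx.
Qed.

(** The extreme monomials of the product have equal degree, so those of each factor do as well. The
    monomial order refines the degree, which squeezes all monomials in between. *)
Lemma homogeneous_factor d f g : f * g != 0 -> f * g \is d.-homog ->
  exists e, g \is e.-homog.
Proof.
move=> fg0 fgd; have := fg0; rewrite mulf_eq0 negb_or => /andP[f0 g0].
have last_fg : (mlast f + mlast g)%MM \in msupp (f * g).
  by rewrite mcoeff_msupp mcoeff_mlastM // mulf_neq0 // -mcoeff_msupp mlast_supp.
have lead_fg : (mlead f + mlead g)%MM \in msupp (f * g).
  by rewrite -mleadM // mlead_supp.
have deg1 : mdeg (mlast f + mlast g)%MM = d by exact: dhomog_mf fgd _ last_fg.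
have deg2 : mdeg (mlead f + mlead g)%MM = d by exact: dhomog_mf fgd _ lead_fg.
rewrite !mdegD in deg1 deg2.
have := lemc_mdeg (mlast_lemc (mlead_supp f0)) => le1.
have gE : mdeg (mlast g) = mdeg (mlead g).
  apply/eqP; rewrite eqn_leq (lemc_mdeg (mlast_lemc (mlead_supp g0))) /=.
  by rewrite -(leq_add2l (mdeg (mlead f))) deg2 -deg1 leq_add2r.
exists (mdeg (mlead g)); apply/dhomogP => m mg /=; apply/eqP.
by rewrite eqn_leq (lemc_mdeg (msupp_le_mlead mg)) -gE (lemc_mdeg (mlast_lemc mg)).
Qed.

Lemma dhomog_msizeE d f : f != 0 -> f \is d.-homog -> msize f = d.+1.
Proof. by move=> f0 /dhomog_mf/(_ _ (mlead_supp f0)) <-; rewrite mlead_deg. Qed.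

Lemma msize_le1_unit f : f != 0 -> (msize f <= 1)%N ->
  exists c : K, c != 0 /\ f = c%:MP.
Proof.
move=> f0 /msize1_polyC fE; exists f@_0%MM; split=> //.
by apply: contra_neq f0 => c0; rewrite fE c0.
Qed.

(** A common factor of maximal size plays the role of the gcd: a nonconstant common factor of the
    quotients would enlarge it. *)
Lemma reduce_forms k (F : 'I_k -> {mpoly K[n]}) i0 : F i0 != 0 ->
  exists g G, [/\ g != 0, forall i, F i = G i * g &
    forall h, (forall i, exists q, G i = q * h) ->
      exists c : K, c != 0 /\ h = c%:MP].
Proof.
move=> F0.
pose P m := `[< exists g G, (forall i, F i = G i * g) /\ msize g = m >].
have exP : exists m, P m.
  exists (msize (1 : {mpoly K[n]})); apply/asboolP; exists 1, F.
  by split=> // i; rewrite mulr1.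
have ubP m : P m -> (m <= msize (F i0))%N.
  move=> /asboolP[g [G [FE <-]]].
  have := F0; rewrite FE mulf_eq0 negb_or => /andP[G0 g0].
  by rewrite msizeM // (mpolySpred _ G0) addSn leq_addl.
case: (ex_maxnP exP ubP) => m /asboolP[g [G [FE gm]]] mmax.
have := F0; rewrite FE mulf_eq0 negb_or => /andP[G0 g0].
exists g, G; split=> // h hG.
have [H HE] := choice hG.
have h0 : h != 0 by apply: contra_neq G0 => h0; rewrite HE h0 mulr0.
apply: msize_le1_unit => //.
have /mmax : P (msize (h * g)).
  by apply/asboolP; exists (h * g), H; split=> // i; rewrite mulrA -HE.
rewrite msizeM // -gm (mpolySpred _ h0) (mpolySpred _ g0); lia.
Qed.

End Homogeneity.

(** * Iterates and their degrees *)

Section Composition.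
Variables (K : fieldType) (n k : nat).

Lemma mmap_homogZ (S : comNzRingType) (f : {rmorphism K -> S}) (h : 'I_n -> S)
    (c : S) d (p : {mpoly K[n]}) :
  p \is d.-homog -> mmap f (fun i => c * h i) p = c ^+ d * mmap f h p.
Proof.
move=> /dhomog_mf pd; rewrite /mmap big_distrr /=; apply: eq_big_seq => m /pd <-.
rewrite mulrCA; congr (_ * _); rewrite /mmap1.
under eq_bigr do rewrite exprMn.
by rewrite big_split /= prodrXr -mdegE.
Qed.

Lemma mevalZ_homog (c : K) (v : 'I_n -> K) d (p : {mpoly K[n]}) :
  p \is d.-homog -> p.@[fun i => c * v i] = c ^+ d * p.@[v].
Proof. exact: mmap_homogZ. Qed.

Lemma comp_mpolyZ_homog (g : {mpoly K[k]}) (F G : n.-tuple {mpoly K[k]}) d p :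
    (forall i, tnth F i = g * tnth G i) ->
  p \is d.-homog -> p \mPo F = g ^+ d * (p \mPo G).
Proof.
move=> FE pd; rewrite /comp_mpoly -(mmap_homogZ _ _ _ pd).
by apply: eq_bigr => m _; congr (_ * _); exact: mmap1_eq.
Qed.

Lemma comp_mpoly_homog d e (G : n.-tuple {mpoly K[k]}) (p : {mpoly K[n]}) :
    (forall i, tnth G i \is e.-homog) -> p \is d.-homog ->
  p \mPo G \is (d * e).-homog.
Proof.
move=> Ge /dhomog_mf pd; rewrite comp_mpolyE big_seq; apply: rpred_sum => m /pd mE.
apply: rpredZ; rewrite -mE /= mdegE big_distrl /=.
apply: (big_ind2 (fun (q : {mpoly K[k]}) d => q \is d.-homog)).
- exact: dhomog1.
- by move=> q a q' a'; exact: dhomogM.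
- by move=> i _; rewrite mulnC; exact: dhomogMn.
Qed.

Lemma comp_mpolyA l (p : {mpoly K[n]}) (F : n.-tuple {mpoly K[k]})
    (G : k.-tuple {mpoly K[l]}) :
  (p \mPo F) \mPo G = p \mPo [tuple tnth F i \mPo G | i < n].
Proof.
rewrite !(comp_mpolyEX p) raddf_sum; apply: eq_bigr => m _ /=.
rewrite comp_mpolyZ !comp_mpolyX rmorph_prod; congr (_ *: _).
by apply: eq_bigr => i _; rewrite rmorphXn tnth_mktuple.
Qed.
End Composition.

Section Iterates.
Variable N : nat.
Implicit Types (F G : forms N) (phi : ratmap N) (P : proj_space N).

Lemma iter_formsS F n : iter_forms F n.+1 = comp_forms F (iter_forms F n).
Proof. by []. Qed.

Lemma iter_formsD F m n :
  iter_forms F (m + n) = comp_forms (iter_forms F m) (iter_forms F n).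
Proof.
elim: m => [|m IHm].
  by apply: eq_from_tnth => i; rewrite !tnth_mktuple comp_mpolyXU (tnth_nth 0).
rewrite addSn !iter_formsS IHm; apply: eq_from_tnth => i.
by rewrite !tnth_mktuple comp_mpolyA.
Qed.

Lemma iter_forms_homog phi n :
  homogeneous (iter_forms phi n) (ratmap_deg phi ^ n).
Proof.
elim: n => [|n IHn] i; first by rewrite tnth_mktuple dhomogX /= mdeg1.
rewrite iter_formsS tnth_mktuple expnS.
exact/comp_mpoly_homog/ratmap_homogeneous.
Qed.

Lemma coords_neq0 P : coords P != 0.
Proof. exact: (valP (repr P)). Qed.

Lemma coords_apply phi P : ~ indeterminacy phi P ->
  exists c : algC, c != 0 /\
    coords (ratmap_apply phi P) = c *: eval_forms phi (coords P).
Proof.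
move=> /eqP Pphi; pose y := insubd (repr P) (eval_forms phi (coords P)).
have yE : val y = eval_forms phi (coords P) by rewrite insubdK.
have /eqmodP : repr (\pi_(proj_space N) y) = y %[mod proj_space N] by rewrite reprK.
rewrite /= (proportional_sym _) => /asboolP[c [c0 cE]].
by exists c; rewrite -yE -cE.
Qed.

Lemma eval_formsZ F d (c : algC) x : homogeneous F d ->
  eval_forms F (c *: x) = c ^+ d *: eval_forms F x.
Proof.
move=> Fd; apply/rowP => i; rewrite !mxE -(mevalZ_homog _ _ (Fd i)).
by apply: meval_eq => j; rewrite mxE.
Qed.

Lemma eval_forms_comp F G x :
  eval_forms (comp_forms F G) x = eval_forms F (eval_forms G x).
Proof.
apply/rowP => i; rewrite !mxE tnth_mktuple comp_mpoly_meval.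
by apply: meval_eq => j; rewrite mxE.
Qed.

Lemma coords_iter phi P n : orbit_defined phi P ->
  exists c : algC, c != 0 /\
    coords (iter n (ratmap_apply phi) P) =
      c *: eval_forms (iter_forms phi n) (coords P).
Proof.
move=> Pphi; elim: n => [|n [c [c0 cE]]].
  exists 1; rewrite oner_eq0 scale1r; split=> //; apply/rowP => i.
  by rewrite mxE tnth_mktuple mevalXU.
have [b [b0 bE]] := coords_apply (Pphi n).
exists (b * c ^+ ratmap_deg phi); split; first by rewrite mulf_neq0 ?expf_neq0.
rewrite iterS bE cE iter_formsS eval_forms_comp.
by rewrite (eval_formsZ _ _ (@ratmap_homogeneous _ phi)) scalerA.
Qed.

Lemma orbit_defined_iter phi P n : orbit_defined phi P ->
  orbit_defined phi (iter n (ratmap_apply phi) P).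
Proof. by move=> Pphi m; rewrite -iterD; exact: Pphi. Qed.

Lemma reduced_unit phi (p : {mpoly algC[N.+1]}) :
  (forall i, divides p (tnth (ratmap_forms phi) i)) -> p \is a GRing.unit.
Proof.
move=> /(@ratmap_reduced _ phi)[c [c0 ->]]; apply/unitrPr.
by exists c^-1%:MP; rewrite -mpolyCM mulfV ?mpolyC1.
Qed.

Lemma ratmap_forms_neq0 phi : exists i, tnth (ratmap_forms phi) i != 0.
Proof.
apply: contrapT => phi0.
have [|c [c0 /esym/eqP]] := @ratmap_reduced _ phi 0.
  move=> i; exists 0; rewrite mulr0; apply/eqP/negPn/negP => phii.
  by apply: phi0; exists i.
by rewrite mpolyC_eq0 (negPf c0).
Qed.

Lemma same_map_factor phi G : same_map phi G ->
  exists g, forall i, tnth G i = g * tnth (ratmap_forms phi) i.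
Proof.
move=> phiG; have [i0 i0P] := ratmap_forms_neq0 phi.
exact: (proportional_to_coprime i0P (@reduced_unit phi) phiG).
Qed.

(** * Reduced iterates of a dominant map *)

Section Dominant.
Variable phi : ratmap N.
Hypothesis phi_dom : dominant phi.

(** Dominance in algebraic form: the components of [phi] satisfy no nontrivial homogeneous
    relation. *)
Lemma dominant_comp_eq0 e (Q : {mpoly algC[N.+1]}) :
  Q \is e.-homog -> Q \mPo ratmap_forms phi = 0 -> Q = 0.
Proof.
move=> Qe Qphi; apply: (phi_dom Qe) => P /coords_apply[c [c0 ->]].
transitivity (Q.@[fun j => c * eval_forms phi (coords P) 0 j]).
  by apply: meval_eq => j; rewrite mxE.
rewrite (mevalZ_homog _ _ Qe).
transitivity (c ^+ e * (Q \mPo ratmap_forms phi).@[fun j => coords P 0 j]).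
  by rewrite comp_mpoly_meval; congr (_ * _); apply: meval_eq => j; rewrite mxE.
by rewrite Qphi meval0 mulr0.
Qed.

Lemma iter_comp_eq0 n e (Q : {mpoly algC[N.+1]}) :
  Q \is e.-homog -> Q \mPo iter_forms phi n = 0 -> Q = 0.
Proof.
elim: n e Q => [|n IHn] e Q Qe; first by rewrite comp_mpoly_id.
rewrite iter_formsS -comp_mpolyA => /IHn Q0; apply: dominant_comp_eq0 (Qe) _.
apply: (Q0 (e * ratmap_deg phi)%N); apply: comp_mpoly_homog Qe.
exact: ratmap_homogeneous.
Qed.

Lemma iter_forms_neq0 n i : tnth (iter_forms phi n) i != 0.
Proof.
apply/eqP => Fi0; have /eqP : 'X_i = 0 :> {mpoly algC[N.+1]}.
  apply: (@iter_comp_eq0 n 1); first by rewrite dhomogX /= mdeg1.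
  by rewrite comp_mpolyXU -tnth_nth.
by move=> /eqP/(congr1 (mcoeff U_(i)))/eqP; rewrite mcoeffXU eqxx mcoeff0 oner_eq0.
Qed.

(** Shows that the [xget] in [iterate_deg] never falls back on its default: dividing the iterated
    forms by a maximal common factor gives a reduced representative. *)
Lemma reduced_iterate n : exists psi : ratmap N,
  ratmap_deg psi = iterate_deg phi n /\
  exists g, g != 0 /\
    forall i, tnth (iter_forms phi n) i = g * tnth (ratmap_forms psi) i.
Proof.
suff [psi0 psi0E] : exists psi : ratmap N, same_map psi (iter_forms phi n).
  have [psi [psiF psid]] : [set d | exists psi : ratmap N,
      same_map psi (iter_forms phi n) /\ ratmap_deg psi = d] (iterate_deg phi n).
    by apply: xgetPex; exists (ratmap_deg psi0), psi0.
  exists psi; split=> //; have [g gE] := same_map_factor psiF; exists g; split=> //.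
  by apply: contra_neq (iter_forms_neq0 n ord0) => g0; rewrite gE g0 mul0r.
have [g [G [g0 FE Gred]]] := reduce_forms (iter_forms_neq0 n ord0).
have G0 i : G i != 0.
  by apply: contra_neq (iter_forms_neq0 n i) => Gi0; rewrite FE Gi0 mul0r.
have Fhom i := iter_forms_homog phi n i.
(* All components lose the same degree, that of [g], which is [(msize g).-1]. *)
have Ghom : homogeneous [tuple G i | i < N.+1] (ratmap_deg phi ^ n - (msize g).-1).
  move=> i; rewrite tnth_mktuple.
  have [||e Ge] := @homogeneous_factor _ _ (ratmap_deg phi ^ n) g (G i).
  - by rewrite mulf_neq0.
  - by rewrite mulrC -FE.
  have := dhomog_msizeE (iter_forms_neq0 n i) (Fhom i).
  rewrite FE msizeM // (dhomog_msizeE (G0 i) Ge) => degE.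
  rewrite (_ : (_ - _)%N = e) //; move: degE; rewrite (mpolySpred _ g0); lia.
have Gred' : no_common_factor [tuple G i | i < N.+1].
  by move=> h hG; apply: Gred => i; have := hG i; rewrite tnth_mktuple.
exists (RatMap Ghom Gred') => i j /=; rewrite !tnth_mktuple !FE; ring.
Qed.

(** Substituting reduced forms into each other represents the [m + n]-th iterate in degree the
    product of the two degrees. The result [L] may still have a common factor [k], and removing it
    can only lower the degree. *)
Lemma iterate_degD m n :
  (iterate_deg phi (m + n) <= iterate_deg phi m * iterate_deg phi n)%N.
Proof.
have [psim [<- [gm [gm0 gmE]]]] := reduced_iterate m.
have [psin [<- [gn [gn0 gnE]]]] := reduced_iterate n.
have [psi [<- [h [h0 hE]]]] := reduced_iterate (m + n).
pose H := (gm \mPo iter_forms phi n) * gn ^+ ratmap_deg psim.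
pose L := comp_forms psim psin.
(* By homogeneity of [psim], the inner factor [gn] comes out to the power [ratmap_deg psim]. *)
have HL i : tnth (iter_forms phi (m + n)) i = H * tnth L i.
  rewrite iter_formsD !tnth_mktuple gmE rmorphM /= -mulrA; congr (_ * _).
  exact: comp_mpolyZ_homog gnE (@ratmap_homogeneous _ psim i).
have Fn0 i := iter_forms_neq0 (m + n) i.
have H0 : H != 0 by apply: contra_neq (Fn0 ord0) => H0; rewrite HL H0 mul0r.
have [i j|k kE] := @same_map_factor psi L.
  by apply: (mulfI h0); apply: (mulfI H0); rewrite !(mulrA h) -!hE !HL; ring.
have L0 i : tnth L i != 0.
  by apply: contra_neq (Fn0 i) => L0; rewrite HL L0 mulr0.
have := L0 ord0; rewrite kE mulf_eq0 negb_or => /andP[k0 psi0].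
have Lhom : tnth L ord0 \is (ratmap_deg psim * ratmap_deg psin).-homog.
  by rewrite tnth_mktuple; apply: comp_mpoly_homog; exact: ratmap_homogeneous.
have := dhomog_msizeE (L0 ord0) Lhom.
rewrite kE msizeM // (dhomog_msizeE psi0 (@ratmap_homogeneous _ psi ord0)).
rewrite (mpolySpred _ k0); lia.
Qed.

(** An iterate of degree 0 is constant, so two of its coordinates satisfy a linear relation, against
    dominance. A second coordinate exists because on a single one a reduced map has degree 0. *)
Lemma iterate_deg_gt0 n : (2 <= ratmap_deg phi)%N -> (0 < iterate_deg phi n)%N.
Proof.
move=> d2; have [psi [<- [g [g0 gE]]]] := reduced_iterate n.
have psi0 i : tnth (ratmap_forms psi) i != 0.
  by apply: contra_neq (iter_forms_neq0 n i) => psi0; rewrite gE psi0 mulr0.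
rewrite lt0n; apply/eqP => psid.
have psiC i : exists c : algC, c != 0 /\ tnth (ratmap_forms psi) i = c%:MP.
  apply: msize_le1_unit => //.
  by rewrite (dhomog_msizeE (psi0 i) (@ratmap_homogeneous _ psi i)) psid.
have [i1 i1P] : exists i1 : 'I_N.+1, i1 != ord0.
  apply: contrapT => noi1.
  have phi_ord i : i = ord0 :> 'I_N.+1.
    by apply/eqP/negPn/negP => i0; apply: noi1; exists i.
  have [|c [c0 cE]] := @ratmap_reduced _ phi (tnth (ratmap_forms phi) ord0).
    by move=> i; exists 1; rewrite mul1r (phi_ord i).
  have phi0 : tnth (ratmap_forms phi) ord0 != 0 by rewrite cE mpolyC_eq0.
  have := dhomog_msizeE phi0 (@ratmap_homogeneous _ phi ord0).
  by rewrite cE msizeC c0 => -[degE]; rewrite -degE in d2.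
have [a [a0 aE]] := psiC ord0; have [b [b0 bE]] := psiC i1.
have /(congr1 (mcoeff U_(i1))) : a *: 'X_i1 - b *: 'X_ord0 = 0 :> {mpoly algC[N.+1]}.
  apply: (@iter_comp_eq0 n 1).
    by apply: rpredB; apply: rpredZ; rewrite dhomogX /= mdeg1.
  rewrite rmorphB /= !comp_mpolyZ !comp_mpolyXU -!tnth_nth !gE aE bE.
  by rewrite -!mul_mpolyC; ring.
rewrite mcoeffB !mcoeffZ !mcoeffXU eqxx eq_sym (negPf i1P) mulr1 mulr0 subr0 mcoeff0.
by move/eqP; rewrite (negPf a0).
Qed.

(** The scalar contains the value of the removed factor at [P]; it is nonzero because the
    coordinates of the iterate are. A single [psi] serves all points, so that the height constant
    does not depend on the point. *)
Lemma coords_iterate n : exists psi : ratmap N,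
  ratmap_deg psi = iterate_deg phi n /\
  forall P, orbit_defined phi P -> exists c : algC, c != 0 /\
    coords (iter n (ratmap_apply phi) P) = c *: eval_forms psi (coords P).
Proof.
have [psi [psid [g [g0 gE]]]] := reduced_iterate n.
exists psi; split=> // P Pphi; have [c [c0 cE]] := coords_iter n Pphi.
pose x := coords P.
exists (c * g.@[fun j => x 0 j]).
have E : coords (iter n (ratmap_apply phi) P) =
    (c * g.@[fun j => x 0 j]) *: eval_forms psi x.
  by rewrite cE; apply/rowP => i; rewrite !mxE gE mevalM mulrA.
split=> //; apply: contra_neq (coords_neq0 (iter n (ratmap_apply phi) P)) => z0.
by rewrite E z0 scale0r.
Qed.

End Dominant.
End Iterates.

(** * Absolute values on Qbar *)

Section Growth.
Variable R : realType.

(** The quadratic term is what beats a linear function of arbitrary slope, beyond the reach of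
    Bernoulli's inequality. *)
Lemma expr1D_ge_quadratic (d : R) n : 0 <= d ->
  1 + n%:R * d + 'C(n, 2)%:R * d ^+ 2 <= (1 + d) ^+ n.
Proof.
move=> d0; elim: n => [|n IHn]; first by rewrite bin0n !mul0r !addr0 expr0.
apply: (@le_trans _ _ ((1 + d) * (1 + n%:R * d + 'C(n, 2)%:R * d ^+ 2))); last first.
  by rewrite [leRHS]exprS ler_wpM2l ?addr_ge0.
rewrite binS bin1 natrD -natr1 -subr_ge0.
have c0 : 0 <= 'C(n, 2)%:R * d ^+ 3 :> R by rewrite mulr_ge0 ?exprn_ge0.
by apply: (le_trans c0); rewrite le_eqVlt; apply/orP; left; apply/eqP; ring.
Qed.

Lemma linear_le_expr (q A C : R) : 1 < q ->
  exists n0, forall n, (n0 <= n)%N -> A + C * n%:R <= q ^+ n.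
Proof.
move=> q1; pose d := q - 1; have d0 : 0 < d by rewrite subr_gt0.
pose K := `|A| + `|C|; have K0 : 0 <= K by rewrite addr_ge0.
(* For n > m the quadratic term n(n-1)/2 d^2 is at least n K, which bounds [A + C * n] once n is
   positive. *)
have [m mP] : exists m : nat, 2 * K / d ^+ 2 <= m%:R.
  exists (Num.bound (2 * K / d ^+ 2)); apply/ltW/archi_boundP.
  by rewrite divr_ge0 ?mulr_ge0 ?exprn_ge0 // ltW.
exists m.+1 => n mn.
have -> : q = 1 + d by rewrite addrC subrK.
apply: le_trans (expr1D_ge_quadratic n (ltW d0)).
have binE : 'C(n, 2)%:R = n%:R * (n%:R - 1) / 2 :> R.
  apply: (mulIf (x := 2)); first by rewrite pnatr_eq0.
  rewrite divfK ?pnatr_eq0 // -natrM mulnC -mul_bin_diag bin1 natrM.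
  by rewrite -subn1 natrB // (leq_trans _ mn).
have n1 : 1 <= n%:R :> R by rewrite ler1n (leq_trans _ mn).
have nm : m%:R <= n%:R - 1 :> R by rewrite lerBrDr natr1 ler_nat.
have nK : K <= (n%:R - 1) / 2 * d ^+ 2.
  have := le_trans mP nm; rewrite ler_pdivrMr ?exprn_gt0 // => H.
  by rewrite mulrAC ler_pdivlMr // mulrC.
apply: (@le_trans _ _ (n%:R * K)).
  rewrite mulrDr lerD //; last by rewrite mulrC ler_wpM2l // ler_norm.
  by apply: (le_trans (ler_norm A)); rewrite ler_peMl.
rewrite binE; apply: (@le_trans _ _ (n%:R * ((n%:R - 1) / 2 * d ^+ 2))).
  by rewrite ler_wpM2l.
rewrite -!mulrA lerDr addr_ge0 // mulr_ge0 // ltW //.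
Qed.
End Growth.

Section AbsoluteValues.
Variables (R : realType) (abs : absQbar R).
Implicit Types (v : placeQ) (x y : algC).

Lemma absv0 v : abs v 0 = 0.
Proof.
have -> : 0 = ratr 0 :> algC by rewrite rmorph0.
by rewrite absv_ratr; case: v => [p|] /=; rewrite ?eqxx ?rmorph0 ?normr0.
Qed.

Lemma absv_gt0 v x : x != 0 -> 0 < abs v x.
Proof.
move=> x0; rewrite lt0r absv_ge0 andbT.
by apply: contra_neq x0; exact: absv_eq0.
Qed.

Lemma absv1 v : abs v 1 = 1.
Proof.
apply: (@mulfI _ (abs v 1)); first by rewrite gt_eqF // absv_gt0 ?oner_eq0.
by rewrite -absvM !mulr1.
Qed.

Lemma absvX v x n : abs v (x ^+ n) = abs v x ^+ n.
Proof. by elim: n => [|n IHn]; rewrite ?expr0 ?absv1 // !exprS absvM IHn. Qed.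

Lemma absv_prod v (I : Type) (r : seq I) (F : I -> algC) :
  abs v (\prod_(i <- r) F i) = \prod_(i <- r) abs v (F i).
Proof. by rewrite (big_morph (abs v) (absvM abs v) (absv1 v)). Qed.

Lemma absvV v x : abs v x^-1 = (abs v x)^-1.
Proof.
have [->|x0] := eqVneq x 0; first by rewrite !(invr0, absv0).
apply: (@mulfI _ (abs v x)); first by rewrite gt_eqF // absv_gt0.
by rewrite -absvM !mulfV ?absv1 // gt_eqF // absv_gt0.
Qed.

Lemma absvN v x : abs v (- x) = abs v x.
Proof.
rewrite -mulN1r absvM; suff -> : abs v (-1) = 1 by rewrite mul1r.
apply: (pexpIrn (n := 2)); rewrite ?nnegrE ?absv_ge0 ?ler01 //.
by rewrite -absvX sqrrN !expr1n absv1.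
Qed.

Lemma absv_sum v (I : Type) (r : seq I) (F : I -> algC) :
  abs v (\sum_(i <- r) F i) <= \sum_(i <- r) abs v (F i).
Proof.
elim/big_ind2 : _ => [|x a y b xa yb|//]; first by rewrite absv0.
by rewrite (le_trans (absvD _ _ _ _)) // lerD.
Qed.

Lemma absv_nat p (n : nat) : abs (Some p) n%:R <= 1.
Proof.
rewrite -[n%:R](rmorph_nat (@ratr algC)) absv_ratr /=.
case: ifPn => // n0; rewrite !(pmulrn (1 : rat) n) denq_int numq_int logn1 sub0r.
rewrite -exprnN invf_le1 ?exprn_gt0 ?ltr0n ?prime_gt0 ?(valP p) //.
by rewrite exprn_ege1 // ler1n prime_gt0 ?(valP p).
Qed.

(* The triangle inequality for [(x + y) ^+ n], whose binomial coefficients have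
   absolute value at most 1, as [n] goes to infinity. *)
Lemma absv_ultra p x y :
  abs (Some p) (x + y) <= Num.max (abs (Some p) x) (abs (Some p) y).
Proof.
set v := Some p; set M := Num.max _ _.
have xM : abs v x <= M by rewrite le_max lexx.
have yM : abs v y <= M by rewrite le_max lexx orbT.
have M0 : 0 <= M := le_trans (absv_ge0 _ _ _) xM.
have powM n : abs v (x + y) ^+ n <= n.+1%:R * M ^+ n.
  rewrite -absvX exprDn (le_trans (absv_sum _ _ _)) //.
  apply: (@le_trans _ _ (\sum_(i < n.+1) M ^+ n)); last first.
    by rewrite sumr_const card_ord mulr_natl.
  apply: ler_sum => i _; rewrite -mulr_natr absvM absvM !absvX.
  rewrite -[leRHS]mulr1 ler_pM ?mulr_ge0 ?exprn_ge0 ?absv_ge0 ?absv_nat //.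
  rewrite -[X in _ <= M ^+ X](subnK (leq_ord i)) exprD.
  by rewrite ler_pM ?exprn_ge0 ?absv_ge0 // lerXn2r ?nnegrE ?absv_ge0.
have [M00|Mn0] := eqVneq M 0.
  by have := powM 1%N; rewrite M00 !expr1 mulr0.
have {}M0 : 0 < M by rewrite lt0r Mn0.
rewrite leNgt; apply/negP => Mlt.
(* The bound [2 + n] just exceeds the factor [n.+1] of [powM]. *)
have [|n0 /(_ _ (leqnn n0))] := @linear_le_expr R (abs v (x + y) / M) 2 1.
  by rewrite ltr_pdivlMr // mul1r.
apply/negP; rewrite -ltNge expr_div_n ltr_pdivrMr ?exprn_gt0 //.
apply: le_lt_trans (powM n0) _; rewrite ltr_pM2r ?exprn_gt0 //.
by rewrite -natr1 mul1r addrC ltrD2r ltr1n.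
Qed.

Lemma absv_ultra_sum p (I : Type) (r : seq I) (F : I -> algC) (M : R) :
  0 <= M -> (forall i, abs (Some p) (F i) <= M) ->
  abs (Some p) (\sum_(i <- r) F i) <= M.
Proof.
move=> M0 FM; elim/big_ind : _ => [|x y xM yM|//]; first by rewrite absv0.
by rewrite (le_trans (absv_ultra _ _ _)) // ge_max xM.
Qed.

(** If [b] had absolute value above 1, the leading term would dominate: solving the equation for it
    bounds its absolute value by that of a lower power of [b]. *)
Lemma absv_integral p (P : {poly algC}) b : P \is monic ->
  (forall i, abs (Some p) P`_i <= 1) -> root P b -> abs (Some p) b <= 1.
Proof.
move=> Pmonic P1 Pb; set v := Some p; rewrite leNgt; apply/negP => b1.
have szP : (1 < size P)%N by apply: root_size_gt1 Pb; exact: monic_neq0.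
have [n szPE] : exists n, size P = n.+2.
  by case: (size P) szP => [|[|n]] // _; exists n.
have : b ^+ n.+1 = - \sum_(i < n.+1) P`_i * b ^+ i.
  apply/eqP; rewrite -addr_eq0 addrC; move: Pb; rewrite rootE horner_coef szPE.
  rewrite big_ord_recr /=; have := monicP Pmonic.
  by rewrite lead_coefE szPE /= => ->; rewrite mul1r.
move=> /(congr1 (abs v)); rewrite absvN absvX => bE.
have : abs v b ^+ n.+1 <= abs v b ^+ n.
  rewrite bE; apply: absv_ultra_sum => [|i]; first by rewrite exprn_ge0 ?absv_ge0.
  rewrite absvM absvX -[leRHS]mul1r ler_pM ?exprn_ge0 ?absv_ge0 //.
  by rewrite ler_weXn2l ?(ltW b1) // -ltnS.
by rewrite leNgt exprS ltr_pMl ?b1 // exprn_gt0 // (lt_trans ltr01).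
Qed.

(** The exceptional list holds the primes of the denominator and also the archimedean place, so that
    outside it the ultrametric inequality is available. *)
Lemma places_of_rat (q : rat) : exists S : seq placeQ,
  forall v, v \notin S -> v != None /\ absQ R v q <= 1.
Proof.
exists (None :: [seq Some p | p <- pmap insub (primes `|denq q|)]).
case=> [p|]; rewrite inE //= => pS; split=> //.
case: ifPn => // q0; rewrite (_ : logn _ `|denq q| = 0%N).
  rewrite sub0r -exprnN invf_le1 ?exprn_gt0 ?ltr0n ?prime_gt0 ?(valP p) //.
  by rewrite exprn_ege1 // ler1n prime_gt0 ?(valP p).
apply/eqP; rewrite -leqn0 leqNgt logn_gt0; apply: contra pS => pq.
by apply/map_f; rewrite mem_pmap; apply/mapP; exists (val p); rewrite // valK.
Qed.

Lemma places_seq (I : eqType) (r : seq I) (T : I -> placeQ -> Prop) :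
  (forall i, i \in r -> exists S : seq placeQ, forall v, v \notin S -> T i v) ->
  exists S : seq placeQ, forall v, v \notin S -> forall i, i \in r -> T i v.
Proof.
elim: r => [|i r IHr] H; first by exists [::].
have [S SP] := H i (mem_head _ _).
have [|S' S'P] := IHr; first by move=> j jr; apply: H; rewrite inE jr orbT.
exists (S ++ S') => v; rewrite mem_cat negb_or => /andP[/SP Ti /S'P Tr] j.
by rewrite inE => /predU1P[->|/Tr].
Qed.

Lemma root_ratr_aut (sigma : {rmorphism algC -> algC}) (p : {poly rat}) a :
  root (map_poly ratr p) a -> root (map_poly ratr p) (sigma a).
Proof.
move=> pa; rewrite -(fmorph_root sigma) in pa; move: pa; congr (root _ _).
by rewrite -map_poly_comp; apply: eq_map_poly => q; rewrite /= fmorph_rat.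
Qed.

Lemma places_integral a : exists S : seq placeQ, forall v, v \notin S ->
  v != None /\ forall sigma : {rmorphism algC -> algC}, abs v (sigma a) <= 1.
Proof.
have [p [pE pmonic _]] := minCpolyP a.
(* The extra entry 0 yields [v != None] and covers the coefficients beyond the size of [p]. *)
have [S SP] : exists S : seq placeQ, forall v, v \notin S ->
    forall q, q \in (0 : rat) :: p -> v != None /\ absQ R v q <= 1.
  by apply: places_seq => q _; exact: places_of_rat.
exists S => v /SP vp; split; first by have [] := vp 0 (mem_head _ _).
move=> sigma; have : v != None by have [] := vp 0 (mem_head _ _).
case: v vp => // q vp _; apply: (@absv_integral _ (map_poly ratr p)).
- by rewrite map_monic.
- move=> i; rewrite coef_map /= absv_ratr; have [ip|pi] := ltnP i (size p).
    by have [] := vp p`_i; rewrite // inE mem_nth ?orbT.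
  by have [] := vp 0 (mem_head _ _); rewrite nth_default.
- by apply: root_ratr_aut; rewrite -pE root_minCpoly.
Qed.

(** Integrality of both [a] and its inverse. *)
Lemma places_unit a : a != 0 -> exists S : seq placeQ, forall v, v \notin S ->
  v != None /\ forall sigma : {rmorphism algC -> algC}, abs v (sigma a) = 1.
Proof.
move=> a0; have [S SP] := places_integral a; have [S' S'P] := places_integral a^-1.
exists (S ++ S') => v; rewrite mem_cat negb_or => /andP[/SP[v0 va] /S'P[_ va']].
split=> // sigma; apply/eqP; rewrite eq_le va /=.
have := va' sigma; rewrite fmorphV absvV invf_le1 // absv_gt0 //.
by rewrite fmorph_eq0.
Qed.

End AbsoluteValues.

(** * Conjugates *)

Section Conjugates.

(** In the number field generated by the roots, a splitting field, sending one root to the other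
    extends to an automorphism, and this one extends to Qbar. *)
Lemma aut_conjugate (a b : algC) : root (minCpoly a) b ->
  exists sigma : {rmorphism algC -> algC}, sigma a = b.
Proof.
have [p [pE pmonic pmin]] := minCpolyP a; move=> pb.
have [r rE] := closed_field_poly_normal (minCpoly a).
rewrite (monicP (minCpoly_monic a)) scale1r in rE.
have : b \in r by rewrite -root_prod_XsubC -rE.
have : a \in r by rewrite -root_prod_XsubC -rE root_minCpoly.
have [Qs [QsC [rr rrE genr]]] := num_field_exists r.
rewrite -rrE => /mapP[x xrr xE] /mapP[y yrr yE].
pose pr := map_poly (in_alg Qs) p.
have prE : map_poly QsC pr = map_poly ratr p.
  rewrite -map_poly_comp; apply: eq_map_poly => q.
  by rewrite /= rmorphZ_num rmorph1 mulr1.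
have pr1 : pr \is a polyOver 1%VS.
  by apply/polyOverP => i; rewrite coef_map memvZ ?memv_line.
have split1 : splittingFieldFor 1 pr fullv.
  exists rr => //; congr (_ %= _): (eqpxx pr); apply/(map_poly_inj QsC).
  rewrite prE -pE rE -rrE big_map rmorph_prod /=; apply: eq_bigr => z _.
  by rewrite map_polyXsubC.
have splitx : splittingFieldFor <<1; x>>%VS pr fullv.
  by apply: splittingFieldForS split1; [exact: sub1v | exact: subvf].
pose f := kHomExtend 1 \1 x y.
have hom1 : kHom 1 1 (\1%VF : 'End(Qs)) by rewrite kHom1.
(* The minimal polynomial of [x] has rational coefficients and vanishes at [a], so it is a multiple
   of [p], of which [b] is a root. *)
have rooty : root (map_poly \1%VF (minPoly 1 x)) y.
  rewrite -(fmorph_root QsC) -yE -map_poly_comp.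
  rewrite (@eq_map_poly _ _ _ QsC) => [|u]; last by rewrite /= id_lfunE.
  set p1 := map_poly _ _.
  have [q1 Dp1]: exists q1, p1 = map_poly ratr q1.
    have aP i: (minPoly 1 x)`_i \in 1%VS.
      by apply/polyOverP; apply: minPolyOver.
    have{aP} a_ i := sig_eqW (vlineP _ _ (aP i)).
    exists (\poly_(i < size (minPoly 1 x)) sval (a_ i)).
    apply/polyP=> i; rewrite coef_poly coef_map coef_poly /=.
    case: ifP => _; rewrite ?rmorph0 //; case: (a_ i) => u /= ->.
    by rewrite alg_num_field fmorph_rat.
  have : root p1 a by rewrite xE fmorph_root root_minPoly.
  rewrite Dp1 pmin => /dvdpP[q2 ->]; rewrite rmorphM rootM /=.
  by rewrite -pE pb orbT.
have homf : kHom 1 <<1; x>> f by exact: kHomExtendP.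
have [g homg gE] := kHom_extends (sub1v <<1; x>>%AS) homf pr1 splitx.
pose gM := GRing.isMonoidMorphism.Build _ _ g (kHom_monoid_morphism homg).
pose gRM : {rmorphism _ -> _} := HB.pack (fun_of_lfun g) gM.
have [nu nuE] := extend_algC_subfield_aut QsC gRM.
exists nu; rewrite xE -nuE /= -gE ?memv_adjoin // /f.
by rewrite (kHomExtend_val hom1 rooty) yE.
Qed.

(** By transitivity every root of the minimal polynomial is [a]. Its second coefficient, minus the
    sum of the roots, is then a nonzero integer multiple of [a]. *)
Lemma aut_fixed_rat (a : algC) :
  (forall sigma : {rmorphism algC -> algC}, sigma a = a) -> exists q, a = ratr q.
Proof.
move=> afix; have [p [pE pmonic _]] := minCpolyP a.
have [r rE] := closed_field_poly_normal (minCpoly a).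
rewrite (monicP (minCpoly_monic a)) scale1r in rE.
have ra b : b \in r -> b = a.
  by rewrite -root_prod_XsubC -rE => /aut_conjugate[sigma <-].
have r0 : size r != 0%N.
  by have := root_minCpoly a; rewrite rE root_prod_XsubC; case: (r).
have := coefPn_prod_XsubC r0; rewrite -rE pE coef_map.
rewrite (eq_big_seq (fun=> a)) => [|b /ra//].
rewrite big_const_seq count_predT iter_addr_0 => aE.
exists (- p`_(size r).-1 / (size r)%:R).
rewrite rmorphM fmorphV rmorph_nat /=.
have -> : ratr (- p`_(size r).-1) = - (ratr p`_(size r).-1) :> algC by rewrite rmorphN.
by rewrite [X in - X]aE opprK -[a *+ _]mulr_natr mulfK // pnatr_eq0.
Qed.

Lemma conjugates_self n (z : 'rV[algC]_n) : conjugates z z.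
Proof. by exists idfun; rewrite map_mx_id. Qed.

Lemma conjugates_aut n (z y : 'rV[algC]_n) (sigma : {rmorphism algC -> algC}) :
  conjugates z y -> conjugates z (map_mx sigma y).
Proof. by move=> [tau ->]; exists (sigma \o tau); apply/rowP => i; rewrite !mxE. Qed.

(** Endomorphisms of Qbar are invertible, so one can go back from [y] to [z] and on to [w]. *)
Lemma conjugates_trans n (z y w : 'rV[algC]_n) :
  conjugates z y -> conjugates z w ->
  exists sigma : {rmorphism algC -> algC}, w = map_mx sigma y.
Proof.
move=> [tau ->] [rho ->]; exists (rho \o algC_invaut tau); apply/rowP => i.
by rewrite !mxE /= algC_autK.
Qed.

Lemma finite_conjugates n (z : 'rV[algC]_n) : finite_set (conjugates z).
Proof.
have /choice[r rP] : forall i : 'I_n, exists r : seq algC,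
    forall sigma : {rmorphism algC -> algC}, sigma (z 0 i) \in r.
  move=> i; have [r rE] := closed_field_poly_normal (minCpoly (z 0 i)).
  rewrite (monicP (minCpoly_monic _)) scale1r in rE; exists r => sigma.
  by rewrite -root_prod_XsubC -rE -(minCpoly_aut sigma) root_minCpoly.
pose M := \max_(i < n) size (r i).
pose f (k : {ffun 'I_n -> 'I_M}) : 'rV[algC]_n := \row_i (r i)`_(k i).
apply: (@sub_finite_set _ _ (f @` setT)); last first.
  by apply: finite_image; exact: finite_finset.
move=> _ [sigma ->].
have kP (i : 'I_n) : (index (sigma (z 0%R i)) (r i) < M)%N.
  by apply: leq_trans (leq_bigmax i); rewrite index_mem rP.
exists [ffun i => Ordinal (kP i)] => //; apply/rowP => i.
by rewrite !mxE ffunE /= nth_index.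
Qed.

Lemma mem_conj n (z y : 'rV[algC]_n) :
  (y \in fset_set (conjugates z)) = (y \in conjugates z).
Proof. by rewrite in_fset_set //; exact: finite_conjugates. Qed.

Lemma map_mx_rmorph_inj n (sigma : {rmorphism algC -> algC}) :
  injective (@map_mx _ _ sigma 1 n).
Proof.
move=> y w /rowP yw; apply/rowP => i; have := yw i.
by rewrite !mxE => /fmorph_inj.
Qed.

Lemma conj_aut_stable n (z : 'rV[algC]_n) (sigma : {rmorphism algC -> algC}) :
  [fset map_mx sigma y | y in fset_set (conjugates z)]%fset =
  fset_set (conjugates z).
Proof.
apply/eqP; rewrite eqEfcard; apply/andP; split.
  apply/fsubsetP => _ /imfsetP[y /= yz ->]; move: yz.
  by rewrite !mem_conj !inE; exact: conjugates_aut.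
by rewrite card_imfset //; exact: map_mx_rmorph_inj.
Qed.

(** * Averages over conjugates *)

Section Mean.
Variable R : realType.

Definition conj_mean n (z : 'rV[algC]_n) (g : 'rV[algC]_n -> R) : R :=
  (#|` fset_set (conjugates z)|%:R)^-1 * \sum_(y <- fset_set (conjugates z)) g y.

Lemma conj_card_gt0 n (z : 'rV[algC]_n) : (0 < #|` fset_set (conjugates z)|)%N.
Proof.
rewrite cardfs_gt0; apply/fset0Pn; exists z.
by rewrite mem_conj inE; exact: conjugates_self.
Qed.

Lemma conj_mean_le n (z : 'rV[algC]_n) (g h : 'rV[algC]_n -> R) :
  (forall y, conjugates z y -> g y <= h y) -> conj_mean z g <= conj_mean z h.
Proof.
move=> gh; rewrite ler_wpM2l ?invr_ge0 ?ler0n //.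
rewrite [leLHS]big_seq [leRHS]big_seq ler_sum // => y.
rewrite mem_conj inE; exact: gh.
Qed.

Lemma conj_meanD n (z : 'rV[algC]_n) (g h : 'rV[algC]_n -> R) :
  conj_mean z (fun y => g y + h y) = conj_mean z g + conj_mean z h.
Proof. by rewrite /conj_mean big_split /= mulrDr. Qed.

Lemma conj_meanZ n (z : 'rV[algC]_n) (a : R) (g : 'rV[algC]_n -> R) :
  conj_mean z (fun y => a * g y) = a * conj_mean z g.
Proof. by rewrite /conj_mean -mulr_sumr mulrCA. Qed.

Lemma conj_mean_cst n (z : 'rV[algC]_n) (a : R) : conj_mean z (fun=> a) = a.
Proof.
rewrite /conj_mean big_const_seq count_predT iter_addr_0 -[a *+ _]mulr_natl.
by rewrite mulKf // pnatr_eq0 -lt0n conj_card_gt0.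
Qed.

(* Automorphisms permute the fibres of [f] over the conjugates of [f z], so these
   fibres have the same number of elements. *)
Lemma conj_mean_comp m k (z : 'rV[algC]_m) (f : 'rV[algC]_m -> 'rV[algC]_k)
    (g : 'rV[algC]_k -> R) :
  (forall sigma : {rmorphism algC -> algC},
     f (map_mx sigma z) = map_mx sigma (f z)) ->
  conj_mean z (g \o f) = conj_mean (f z) g.
Proof.
move=> fz; set C := fset_set (conjugates z); set D := fset_set (conjugates (f z)).
have imfD : [fset f y | y in C]%fset = D.
  apply/fsetP => w; apply/imfsetP/idP => /= [[y + ->]|].
    by rewrite !mem_conj !inE => -[sigma ->]; exists sigma; rewrite fz.
  rewrite mem_conj inE => -[sigma ->]; exists (map_mx sigma z); last by rewrite fz.
  by rewrite mem_conj inE; exists sigma.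
pose fib w := [seq y <- C | f y == w].
have fib_le w w' : w \in D -> w' \in D -> (size (fib w) <= size (fib w'))%N.
  rewrite !mem_conj !inE => wD w'D; have [sigma ->] := conjugates_trans wD w'D.
  rewrite -(size_map (map_mx sigma)); apply: uniq_leq_size.
    by rewrite (map_inj_uniq (@map_mx_rmorph_inj m sigma)) filter_uniq ?fset_uniq.
  have CE y : (y \in enum_fset C) = (y \in conjugates z) by exact: mem_conj.
  move=> _ /mapP[y + ->]; rewrite !mem_filter !CE => /andP[/eqP <- /set_mem yz].
  apply/andP; split; last exact/mem_set/conjugates_aut.
  (* Commutation of [f] is assumed only at [z], hence the use of [tau] and of [sigma \o tau]. *)
  case: yz => tau ->; rewrite fz -!map_mx_comp; apply/eqP.
  exact: (fz (sigma \o tau)).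
have [w0 w0D] : exists w0, w0 \in D.
  by exists (f z); rewrite mem_conj inE; exact: conjugates_self.
have sumE (h : 'rV[algC]_k -> R) :
    \sum_(y <- C) h (f y) = (size (fib w0))%:R * \sum_(w <- D) h w.
  rewrite (partition_big_imfset _ f) /= imfD big_distrr /=.
  apply: eq_big_seq => w wD.
  have -> : size (fib w0) = size (fib w) by apply/eqP; rewrite eqn_leq !fib_le.
  rewrite (eq_bigr (fun=> h w)) => [|y /eqP->//].
  by rewrite big_const_seq iter_addr_0 -size_filter mulr_natl.
have cardE : #|` C|%:R = (size (fib w0))%:R * #|` D|%:R :> R.
  have := sumE (fun=> 1); rewrite !big_const_seq !count_predT !iter_addr_0.
  by [].
rewrite /conj_mean -/C -/D sumE cardE invfM mulrACA mulVf ?mul1r //.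
have : #|` C|%:R != 0 :> R by rewrite pnatr_eq0 -lt0n conj_card_gt0.
by rewrite cardE mulf_eq0 negb_or => /andP[].
Qed.

End Mean.
End Conjugates.

(** * Heights *)

Section ProductFormula.
Variables (R : realType) (abs : absQbar R).
Implicit Types (v : placeQ) (S : seq placeQ).

Lemma absv_prime_eq (p p' : {p : nat | prime p}) :
  abs (Some p) (val p')%:R = if p == p' then (val p)%:R^-1 else 1.
Proof.
rewrite -[(val p')%:R](rmorph_nat (@ratr algC)) absv_ratr /=.
rewrite pnatr_eq0 gtn_eqF ?prime_gt0 ?(valP p') //.
rewrite !(pmulrn (1 : rat)) denq_int numq_int logn1 sub0r /=.
rewrite (logn_prime _ (valP p')) -val_eqE /=.
by case: eqP; rewrite ?oppr0 ?expr0z // => _; rewrite exprN1.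
Qed.

Lemma absv_arch_nat (n : nat) : abs None n%:R = n%:R.
Proof.
by rewrite -[n%:R](rmorph_nat (@ratr algC)) absv_ratr /= rmorph_nat normr_nat.
Qed.

(** Sums over all places are written over any duplicate-free list that is large enough, so that
    several of them can later share one list. The induction removes the least prime divisor. *)
Lemma nat_product_formula S (n : nat) : uniq S -> None \in S -> (0 < n)%N ->
  (forall p, (val p %| n)%N -> Some p \in S) ->
  \sum_(v <- S) ln (abs v n%:R) = 0.
Proof.
move=> Su S0; have [k] := ubnP n; elim: k n => // k IHk n nk n0 nS.
have [n1|n1] := leqP n 1.
  have -> : n = 1%N by apply/eqP; rewrite eqn_leq n1.
  by apply: big1_seq => v _; rewrite absv1 ln1.
have pp : prime (pdiv n) by rewrite pdiv_prime.
pose p : {p : nat | prime p} := exist (fun p : nat => is_true (prime p)) _ pp.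
have nE : n = (n %/ pdiv n * pdiv n)%N by rewrite divnK // pdiv_dvd.
set m := (n %/ pdiv n)%N in nE.
have m0 : (0 < m)%N by rewrite divn_gt0 ?pdiv_gt0 // pdiv_leq.
have mn : (m < n)%N by rewrite ltn_Pdiv // prime_gt1.
have p0 : (0 < pdiv n)%N by rewrite pdiv_gt0.
have -> : \sum_(v <- S) ln (abs v n%:R) =
    \sum_(v <- S) ln (abs v m%:R) + \sum_(v <- S) ln (abs v (val p)%:R).
  rewrite -big_split /=; apply: eq_bigr => v _.
  by rewrite {1}nE natrM absvM lnM // posrE absv_gt0 // pnatr_eq0 -lt0n.
rewrite IHk //; last 2 first.
- by rewrite (leq_trans mn) // -ltnS.
- by move=> q qm; apply: nS; rewrite nE dvdn_mulr.
have pS : Some p \in S by apply: nS; rewrite /= pdiv_dvd.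
(* A prime contributes its logarithm at the archimedean place and the opposite at its own place. *)
rewrite add0r (eq_bigr (fun v => (if v == None then ln (val p)%:R else 0) +
    (if v == Some p then - ln (val p)%:R else 0))) => [|v _]; last first.
  case: v => [q|]; last by rewrite absv_arch_nat addr0.
  rewrite absv_prime_eq /= add0r (_ : (Some q == Some p) = (q == p)) //.
  have [->|_] := eqVneq q p; last by rewrite ln1.
  by rewrite lnV // posrE ltr0n prime_gt0 ?(valP p).
have delta v0 (a : R) : v0 \in S -> \sum_(v <- S) (if v == v0 then a else 0) = a.
  move=> v0S; rewrite (bigD1_seq v0) //= eqxx big1 ?addr0 // => v.
  by move=> /negPf ->.
by rewrite big_split /= !delta // subrr.
Qed.

Lemma rat_product_formula (q : rat) : q != 0 -> exists S0 : seq placeQ,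
  forall S, uniq S -> {subset S0 <= S} -> \sum_(v <- S) ln (abs v (ratr q)) = 0.
Proof.
move=> q0.
have num0 : (0 < `|numq q|)%N by rewrite absz_gt0 numq_eq0.
have den0 : (0 < `|denq q|)%N by rewrite absz_gt0 denq_eq0.
exists (None :: [seq Some p | p <- pmap insub (primes (`|numq q| * `|denq q|))]).
move=> S Su S0S.
have pS (p : {p : nat | prime p}) : (val p %| `|numq q| * `|denq q|)%N -> Some p \in S.
  move=> pq; apply: S0S; rewrite inE /=; apply/map_f; rewrite mem_pmap.
  apply/mapP; exists (val p); rewrite ?valK //.
  by rewrite mem_primes (valP p) muln_gt0 num0 den0.
have NS : None \in S by apply: S0S; rewrite mem_head.
have qE v : abs v (ratr q) = abs v (`|numq q|)%:R / abs v (`|denq q|)%:R.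
  have absz z : abs v z%:~R = abs v (`|z|)%:R.
    by case: z => n //; rewrite NegzE mulrNz absvN.
  by rewrite /ratr absvM absvV !absz.
have -> : \sum_(v <- S) ln (abs v (ratr q)) =
    \sum_(v <- S) ln (abs v (`|numq q|)%:R) - \sum_(v <- S) ln (abs v (`|denq q|)%:R).
  rewrite -sumrB; apply: eq_bigr => v _.
  by rewrite qE ln_div // posrE absv_gt0 // pnatr_eq0 -lt0n.
rewrite !nat_product_formula ?subrr // => p pq; apply: pS.
  by rewrite dvdn_mull.
by rewrite dvdn_mulr.
Qed.

(** The product of the conjugates of [c] is fixed by all automorphisms, hence rational, and the
    rational formula applies to it. The scalar is made a vector of length 1 to fit [conj_mean]. *)
Lemma product_formula (c : algC) : c != 0 -> exists S0 : seq placeQ,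
  forall S, uniq S -> {subset S0 <= S} ->
  \sum_(v <- S) conj_mean (const_mx c : 'rV_1) (fun y => ln (abs v (y 0 0))) = 0.
Proof.
move=> c0; set z : 'rV_1 := const_mx c; set C := fset_set (conjugates z).
have y0 y : y \in C -> y 0 0 != 0.
  by rewrite mem_conj inE => -[sigma ->]; rewrite !mxE fmorph_eq0.
pose N := \prod_(y <- C) y 0 0.
have N0 : N != 0 by rewrite prodf_seq_neq0; apply/allP => y /y0 ->.
have [q qE] : exists q, N = ratr q.
  apply: aut_fixed_rat => sigma; rewrite /N rmorph_prod /=.
  have CE : [fset map_mx sigma y | y in C]%fset = C := conj_aut_stable z sigma.
  rewrite -[in RHS]CE big_imfset /=; last first.
    by move=> ? ? _ _; exact: map_mx_rmorph_inj.
  by apply: eq_bigr => y _; rewrite mxE.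
have q0 : q != 0 by apply: contra_neq N0 => q0; rewrite qE q0 rmorph0.
have [S0 S0P] := rat_product_formula q0; exists S0 => S Su S0S.
rewrite /conj_mean -mulr_sumr -/C.
rewrite (_ : \sum_(v <- S) _ = \sum_(v <- S) ln (abs v (ratr q))).
  by rewrite S0P // mulr0.
apply: eq_bigr => v _; rewrite -qE absv_prod.
have {}y0 : forall y, y \in enum_fset C -> y 0 0 != 0 by exact: y0.
elim: (enum_fset C) y0 => [|y r IHr] y0; first by rewrite !big_nil ln1.
have y0r w : w \in r -> w 0 0 != 0 by move=> wr; rewrite y0 // inE wr orbT.
rewrite !big_cons lnM ?posrE; first by rewrite IHr.
  by rewrite absv_gt0 // y0 ?mem_head.
by rewrite big_seq; apply: prodr_gt0 => w wr; rewrite absv_gt0 ?y0r.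
Qed.

End ProductFormula.

(** * Local bounds and the height inequality *)

Section Heights.
Variables (R : realType) (abs : absQbar R).
Implicit Types (v : placeQ) (S : seq placeQ).

Definition vnorm n v (y : 'rV[algC]_n) : R := \big[Num.max/0]_(i < n) abs v (y 0 i).

Lemma vnorm_ge0 n v (y : 'rV[algC]_n) : 0 <= vnorm v y.
Proof. exact: bigmax_ge_id. Qed.

Lemma absv_le_vnorm n v (y : 'rV[algC]_n) i : abs v (y 0 i) <= vnorm v y.
Proof. exact: le_bigmax. Qed.

Lemma vnorm_le n v (y : 'rV[algC]_n) (b : R) :
  0 <= b -> (forall i, abs v (y 0 i) <= b) -> vnorm v y <= b.
Proof. by move=> b0 yb; apply: bigmax_le. Qed.

Lemma vnorm_gt0 n v (y : 'rV[algC]_n) : y != 0 -> 0 < vnorm v y.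
Proof.
move=> /rV0Pn[i yi]; exact: lt_le_trans (absv_gt0 _ _ yi) (absv_le_vnorm _ _ i).
Qed.

(** Outside finitely many places one nonzero coordinate is a unit and all the others are
    integral. *)
Lemma places_vnorm n (x : 'rV[algC]_n) : x != 0 -> exists S0 : seq placeQ,
  forall v, v \notin S0 -> forall y, conjugates x y -> vnorm v y = 1.
Proof.
move=> /rV0Pn[i0 xi0].
have [S0 S0P] := places_unit abs xi0.
have [S1 S1P] : exists S : seq placeQ, forall v, v \notin S ->
    forall i, i \in enum 'I_n ->
    forall sigma : {rmorphism algC -> algC}, abs v (sigma (x 0 i)) <= 1.
  apply: places_seq => i _; have [S SP] := places_integral abs (x 0 i).
  by exists S => v /SP[].
exists (S0 ++ S1) => v; rewrite mem_cat negb_or => /andP[/S0P[_ v1] /S1P v2].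
move=> _ [sigma ->]; apply/eqP; rewrite eq_le; apply/andP; split.
  by apply: vnorm_le => // i; rewrite mxE v2 ?mem_enum.
by have := absv_le_vnorm v (map_mx sigma x) i0; rewrite mxE v1.
Qed.

Lemma weil_heightE N (P : proj_space N) : exists S0 : seq placeQ,
  forall S, uniq S -> {subset S0 <= S} ->
  weil_height abs P = \sum_(v <- S) conj_mean (coords P) (fun y => ln (vnorm v y)).
Proof.
have [S0 S0P] := places_vnorm (coords_neq0 P); exists S0 => S Su S0S.
rewrite /weil_height /conj_mean -mulr_sumr; congr (_ * _).
rewrite (_ : \sum_(v \in _) _ = \sum_(v \in [set` S])
    \sum_(y <- fset_set (conjugates (coords P))) ln (vnorm v y)).
  by rewrite -fsbig_seq.
rewrite (fsbig_widen [set` S] setT) //=.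
  by apply: eq_fsbigr => v _; rewrite fsbig_finite //; exact: finite_conjugates.
move=> v [_ /negP vS] /=; rewrite big1_seq // => y; rewrite mem_conj inE /= => yC.
by rewrite (S0P v _ _ yC) ?ln1 //; apply: contra vS; exact: S0S.
Qed.

Lemma absv_conj_bound v (a : algC) : exists2 B : R, 0 <= B &
  forall sigma : {rmorphism algC -> algC}, abs v (sigma a) <= B.
Proof.
have [r rE] := closed_field_poly_normal (minCpoly a).
rewrite (monicP (minCpoly_monic a)) scale1r in rE.
exists (\sum_(b <- r) abs v b); first by apply: sumr_ge0 => b _; exact: absv_ge0.
move=> sigma; have : sigma a \in r.
  by rewrite -root_prod_XsubC -rE -(minCpoly_aut sigma) root_minCpoly.
move=> /perm_to_rem/(perm_big _) ->; rewrite big_cons lerDl.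
by apply: sumr_ge0 => b _; exact: absv_ge0.
Qed.

(** The factor [beta] depends on the place only, not on [x] or [sigma]. Being at least 1, it has a
    nonnegative logarithm, and being 1 almost everywhere, it has a finite total. *)
Lemma eval_forms_bound N (F : forms N) d : homogeneous F d ->
  exists (S0 : seq placeQ) (beta : placeQ -> R),
  [/\ forall v, 1 <= beta v, forall v, v \notin S0 -> beta v = 1 &
      forall v (sigma : {rmorphism algC -> algC}) x,
        vnorm v (map_mx sigma (eval_forms F x)) <=
          beta v * vnorm v (map_mx sigma x) ^+ d].
Proof.
move=> Fd.
have FE (sigma : {rmorphism algC -> algC}) x i : (map_mx sigma (eval_forms F x)) 0 i =
    \sum_(m <- msupp (tnth F i)) sigma (tnth F i)@_m *
      \prod_j (map_mx sigma x) 0 j ^+ m j.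
  rewrite !mxE mevalE rmorph_sum /=; apply: eq_bigr => m _.
  rewrite rmorphM rmorph_prod /=; congr (_ * _); apply: eq_bigr => j _.
  by rewrite rmorphXn mxE.
have mon v (y : 'rV[algC]_N.+1) i m : m \in msupp (tnth F i) ->
    abs v (\prod_j y 0 j ^+ m j) <= vnorm v y ^+ d.
  move=> /(dhomog_mf (Fd i)) /= <-; rewrite absv_prod mdegE -prodrXr.
  apply: ler_prod => j _; rewrite absv_ge0 absvX /=.
  by rewrite lerXn2r ?nnegrE ?absv_ge0 ?vnorm_ge0 ?absv_le_vnorm.
have [S0 S0P] : exists S : seq placeQ, forall v, v \notin S ->
    forall a, a \in 0 :: flatten [seq [seq (tnth F i)@_m | m <- msupp (tnth F i)]
                                    | i <- enum 'I_N.+1] ->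
    v != None /\ forall sigma : {rmorphism algC -> algC}, abs v (sigma a) <= 1.
  by apply: places_seq => a _; exact: places_integral.
have coefP v i m : v \notin S0 -> m \in msupp (tnth F i) ->
    forall sigma : {rmorphism algC -> algC}, abs v (sigma (tnth F i)@_m) <= 1.
  move=> /S0P vS mF; have [] // := vS (tnth F i)@_m; rewrite inE; apply/orP; right.
  by apply/flattenP; exists [seq (tnth F i)@_m | m <- msupp (tnth F i)];
    [apply: map_f; rewrite mem_enum | exact: map_f].
suff /choice[beta betaP] : forall v, exists b : R, [/\ 1 <= b, v \notin S0 -> b = 1 &
    forall (sigma : {rmorphism algC -> algC}) x i,
      abs v ((map_mx sigma (eval_forms F x)) 0 i) <= b * vnorm v (map_mx sigma x) ^+ d].
  exists S0, beta; split=> [v|v|v sigma x]; have [b1 b2 b3] := betaP v => //.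
  apply: vnorm_le => //.
  by rewrite mulr_ge0 ?exprn_ge0 ?vnorm_ge0 // (le_trans ler01).
(* Outside [S0] the place is ultrametric and the coefficients are integral, so the largest monomial
   decides. *)
move=> v; have [vS|vS] := boolP (v \in S0); last first.
  exists 1; split=> // sigma x i; rewrite mul1r FE big_seq.
  have [vN _] := S0P v vS 0 (mem_head _ _); case: v vS vN => // p vS _.
  rewrite -big_seq; have M0 := exprn_ge0 d (vnorm_ge0 (Some p) (map_mx sigma x)).
  rewrite big_seq_cond big_mkcond /=; apply: absv_ultra_sum => // m.
  case: ifPn => [|_]; last by rewrite absv0.
  rewrite andbT => mF; rewrite absvM -[leRHS]mul1r ler_pM ?absv_ge0 ?(mon _ _ i) //.
  exact: coefP.
(* At the exceptional places the triangle inequality is enough, with coefficients bounded over all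
   their conjugates. *)
have /choice[B BP] : forall a : algC, exists B : R, 0 <= B /\
    forall sigma : {rmorphism algC -> algC}, abs v (sigma a) <= B.
  by move=> a; have [B B0 BP] := absv_conj_bound v a; exists B.
pose b i := \sum_(m <- msupp (tnth F i)) B (tnth F i)@_m.
have b0 i : 0 <= b i by apply: sumr_ge0 => m _; have [] := BP (tnth F i)@_m.
exists (1 + \sum_i b i); split=> //.
- by rewrite lerDl sumr_ge0.
- move=> sigma x i; rewrite FE; apply: le_trans (absv_sum _ _ _ _) _.
  apply: (@le_trans _ _ (b i * vnorm v (map_mx sigma x) ^+ d)).
    rewrite /b big_distrl /= big_seq [leRHS]big_seq; apply: ler_sum => m mF.
    rewrite absvM ler_pM ?absv_ge0 ?(mon _ _ i) //; exact: (BP (tnth F i)@_m).2.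
  rewrite ler_wpM2r ?exprn_ge0 ?vnorm_ge0 // (bigD1 i) //= addrCA lerDl.
  by rewrite addr_ge0 // sumr_ge0.
Qed.

Lemma weil_height_image N (F : forms N) d : homogeneous F d ->
  exists C : R, 0 <= C /\ forall P Q : proj_space N,
    (exists c : algC, c != 0 /\ coords Q = c *: eval_forms F (coords P)) ->
    weil_height abs Q <= d%:R * weil_height abs P + C.
Proof.
move=> Fd; have [S0 [beta [beta1 betaS0 Fbeta]]] := eval_forms_bound Fd.
exists (\sum_(v <- undup S0) ln (beta v)); split.
  by apply: sumr_ge0 => v _; rewrite ln_ge0.
move=> P Q [c [c0 cE]].
have [SP hP] := weil_heightE P; have [SQ hQ] := weil_heightE Q.
have [Sc hc] := product_formula abs c0.
pose S := undup (S0 ++ SP ++ SQ ++ Sc).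
have Su : uniq S by exact: undup_uniq.
have subP : {subset SP <= S} by move=> v vT; rewrite mem_undup !mem_cat vT !orbT.
have subQ : {subset SQ <= S} by move=> v vT; rewrite mem_undup !mem_cat vT !orbT.
have subc : {subset Sc <= S} by move=> v vT; rewrite mem_undup !mem_cat vT !orbT.
rewrite (hP S Su subP) (hQ S Su subQ); have {}hc := hc S Su subc.
set x := coords P; set y := coords Q.
(* [x], [y] and [c] are blocks of [z], so each average becomes one over the conjugates of [z], and a
   single [sigma] acts on all three. *)
pose z := row_mx x (row_mx y (const_mx c : 'rV_1)).
(* The list [S] depends on the points but the constant does not, since [beta] is 1 outside [S0]. *)
have -> : \sum_(v <- undup S0) ln (beta v) = \sum_(v <- S) ln (beta v).
  rewrite [RHS](bigID (mem S0)) /= [X in _ + X]big1 ?addr0; last first.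
    by move=> v /betaS0 ->; rewrite ln1.
  rewrite -[RHS]big_filter; apply: perm_big; apply: uniq_perm.
  - exact: undup_uniq.
  - exact: filter_uniq.
  - by move=> v; rewrite mem_filter !mem_undup !mem_cat; case: (v \in S0).
(* The product formula for [c] is added as a zero, to absorb the scalar place by place. *)
rewrite -[leRHS]add0r -[X in X + _]hc.
rewrite mulr_sumr -!big_split /=; apply: ler_sum => v _.
have mean_x : conj_mean x (fun w => ln (vnorm v w)) =
    conj_mean z (fun w => ln (vnorm v (lsubmx w))).
  rewrite -[x in LHS](row_mxKl x (row_mx y (const_mx c : 'rV_1))).
  by rewrite -(conj_mean_comp (f := lsubmx)) // => sigma; rewrite map_lsubmx.
have mean_y : conj_mean y (fun w => ln (vnorm v w)) =
    conj_mean z (fun w => ln (vnorm v (lsubmx (rsubmx w)))).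
  have -> : y = lsubmx (rsubmx z) by rewrite row_mxKr row_mxKl.
  rewrite -(conj_mean_comp (f := fun w => lsubmx (rsubmx w))) // => sigma.
  by rewrite map_lsubmx map_rsubmx.
have mean_c : conj_mean (const_mx c : 'rV_1) (fun w => ln (abs v (w 0 0))) =
    conj_mean z (fun w => ln (abs v ((rsubmx (rsubmx w)) 0 0))).
  have {1}-> : const_mx c = rsubmx (rsubmx z) :> 'rV_1 by rewrite !row_mxKr.
  rewrite -(conj_mean_comp (f := fun w => rsubmx (rsubmx w))
    (fun w : 'rV_1 => ln (abs v (w 0 0)))) // => sigma.
  by rewrite !map_rsubmx.
rewrite mean_x mean_y mean_c -conj_meanZ.
rewrite -(conj_mean_cst z (ln (beta v))) -!conj_meanD.
apply: conj_mean_le => _ [sigma ->].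
have -> : map_mx sigma z = row_mx (map_mx sigma x)
    (row_mx (map_mx sigma y) (const_mx (sigma c))).
  by rewrite /z !map_row_mx map_const_mx.
rewrite !row_mxKr !row_mxKl mxE.
have x0 : 0 < vnorm v (map_mx sigma x).
  by rewrite vnorm_gt0 // map_mx_eq0 coords_neq0.
have y0 : 0 < vnorm v (map_mx sigma y).
  by rewrite vnorm_gt0 // map_mx_eq0 coords_neq0.
have b0 : 0 < beta v := lt_le_trans ltr01 (beta1 v).
have sc0 : 0 < abs v (sigma c) by rewrite absv_gt0 // fmorph_eq0.
have yle : vnorm v (map_mx sigma y) <=
    abs v (sigma c) * (vnorm v (map_mx sigma x) ^+ d * beta v).
  apply: vnorm_le => [|i]; first by rewrite !mulr_ge0 ?exprn_ge0 // ltW.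
  rewrite mxE /y cE mxE rmorphM absvM ler_wpM2l ?absv_ge0 //.
  rewrite mulrC; apply: le_trans (Fbeta v sigma x).
  by have := absv_le_vnorm v (map_mx sigma (eval_forms F x)) i; rewrite mxE.
have := yle; rewrite -ler_ln ?posrE // ?mulr_gt0 ?exprn_gt0 //.
rewrite lnM ?posrE ?mulr_gt0 ?exprn_gt0 // lnM ?posrE ?exprn_gt0 // lnXn //.
by rewrite mulr_natl.
Qed.
End Heights.

(** * Growth rates *)

Section Asymptotics.
Variable R : realType.

(** Along each residue class modulo [m] the recursion gives [rho ^+ (k * m)] times a factor linear
    in [k], where [A] bounds the first [m] values. As [r] exceeds [rho] strictly, the powers of
    [r / rho] absorb that factor, even for [rho] equal to 1. *)
Lemma affine_growth (u : nat -> R) (m : nat) (rho C r : R) :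
  (0 < m)%N -> 1 <= rho -> 0 <= C ->
  (forall n, u (n + m)%N <= rho ^+ m * u n + C) -> rho < r ->
  exists n0, forall n, (n0 <= n)%N -> u n <= r ^+ n.
Proof.
move=> m0 rho1 C0 uP rhor; have rho0 : 0 < rho := lt_le_trans ltr01 rho1.
pose A := \sum_(i < m) `|u i|.
have A0 : 0 <= A by apply: sumr_ge0.
have ukm k i : (i < m)%N -> u (k * m + i)%N <= rho ^+ (k * m) * (A + k%:R * C).
  move=> im; elim: k => [|k IHk].
    rewrite mul0n mul1r mul0r addr0; apply: le_trans (ler_norm _) _.
    by rewrite /A (bigD1 (Ordinal im)) //= lerDl sumr_ge0.
  rewrite mulSn -addnA addnC; apply: le_trans (uP _) _.
  have rhok : 1 <= rho ^+ (m + k * m) by exact: exprn_ege1.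
  apply: le_trans (lerD (ler_wpM2l (exprn_ge0 m (ltW rho0)) IHk) (lexx C)) _.
  rewrite mulrA -exprD -natr1 mulrDl mul1r addrA [leRHS]mulrDr lerD2l.
  by rewrite ler_peMl.
have [|n0 n0P] := @linear_le_expr R (r / rho) A C; first by rewrite ltr_pdivlMr ?mul1r.
exists n0 => n nn0; rewrite {1}(divn_eq n m).
apply: le_trans (ukm _ _ (ltn_pmod n m0)) _.
have km : (n %/ m * m <= n)%N by exact: leq_trunc_div.
apply: (@le_trans _ _ (rho ^+ n * (A + C * n%:R))).
  apply: ler_pM; first by rewrite exprn_ge0 // ltW.
  - by rewrite addr_ge0 ?mulr_ge0.
  - exact: ler_weXn2l.
  - by rewrite lerD2l mulrC ler_wpM2l // ler_nat leq_div.
have := n0P n nn0; rewrite expr_div_n ler_pdivlMr ?exprn_gt0 //.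
by rewrite mulrC.
Qed.

Lemma powR_inv_le (x r : R) n : (0 < n)%N -> 1 <= r -> x <= r ^+ n ->
  x `^ n%:R^-1 <= r.
Proof.
(* On a negative base [ln] is 0 and the power is 1, so the sign of [x] does not matter. *)
move=> n0 r1 xr; have [x0|x0] := ltP x 0.
  have lnx : ln x = 0 by apply: ln0; exact: ltW.
  by rewrite /powR lnx mulr0 expR0 ifF // lt_eqF.
have r0 : 0 <= r := le_trans ler01 r1.
apply: (@le_trans _ _ ((r ^+ n) `^ n%:R^-1)).
  by rewrite ge0_ler_powR ?nnegrE ?exprn_ge0 ?invr_ge0.
by rewrite -powR_mulrn // -powRrM mulfV ?powRr1 // pnatr_eq0 -lt0n.
Qed.

Lemma powR_invK (x : R) n : (0 < n)%N -> 0 <= x -> (x `^ n%:R^-1) ^+ n = x.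
Proof.
move=> n0 x0; rewrite -powR_mulrn ?powR_ge0 // -powRrM mulVf ?powRr1 //.
by rewrite pnatr_eq0 -lt0n.
Qed.

Lemma powR_inv_ge1 (x : R) n : 1 <= x -> 1 <= x `^ n%:R^-1.
Proof.
by move=> x1; rewrite -[leLHS](powRr0 x) ler_powR // invr_ge0.
Qed.

Lemma limn_esup_le_near (u : (\bar R)^nat) (b : \bar R) n0 :
  (forall n, (n0 <= n)%N -> (u n <= b)%E) -> (limn_esup u <= b)%E.
Proof.
move=> ub; rewrite /limn_esup /limf_esup.
apply: (@le_trans _ _ (ereal_sup (u @` [set n | (n0 <= n)%N]))).
  apply: ereal_inf_lbound; exists [set n | (n0 <= n)%N] => //.
  exact: nbhs_infty_ge.
by apply: ge_ereal_sup => _ [n /= nn0 <-]; exact: ub.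
Qed.

(** Submultiplicativity is the recursion of [affine_growth] with [rho] equal to [a m] and no
    additive constant. So [a n] is eventually below any number exceeding some [a m], while the
    infimum bounds it from below. Index 0, where [a] is 1 by convention, is kept out of [E]. *)
Lemma fekete_root (d : nat -> nat) :
  (forall n, (0 < d n)%N) -> (forall m n, (d (m + n) <= d m * d n)%N) ->
  let a n := (d n)%:R `^ n%:R^-1 : R in
  [/\ 1 <= limn a & forall r, limn a < r -> exists m, (0 < m)%N /\ a m < r].
Proof.
move=> d0 dD a.
have d1 n : 1 <= (d n)%:R :> R by rewrite ler1n.
have a1 n : 1 <= a n by exact: powR_inv_ge1.
pose E : set R := [set a m | m in [set m | (0 < m)%N]].
have hasE : has_inf E.
  by split; [exists (a 1%N), 1%N | exists 1 => _ [m _ <-]].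
have infE n : (0 < n)%N -> inf E <= a n.
  by move=> n0; apply: ge_inf; [exact: hasE.2 | exists n].
have acvg : a @ \oo --> inf E.
  apply/cvgrPdist_le => e e0.
  have infEe : inf E < inf E + e by rewrite ltrDl.
  have [_ [m /= m0 <-] am] := inf_lt hasE.1 infEe.
  have [|n0 n0P] := @affine_growth (fun n => (d n)%:R) m (a m) 0 (inf E + e)
    m0 (a1 m) (lexx 0) _ am.
    by move=> n; rewrite powR_invK // addr0 -natrM ler_nat addnC dD.
  near=> n.
  have nn0 : (n0 <= n)%N by near: n; exact: nbhs_infty_ge.
  have n1 : (0 < n)%N by near: n; exact: nbhs_infty_gt.
  rewrite distrC ger0_norm ?subr_ge0 ?infE // lerBlDl.
  apply: powR_inv_le => //; last exact: n0P.
  by rewrite (le_trans (a1 m)) // ltW.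
rewrite (cvg_lim _ acvg) //; split.
  by apply: lb_le_inf; [exact: hasE.1 | move=> _ [m _ <-]].
move=> r /(inf_lt hasE.1)[_ [m /= m0 <-] amr]; by exists m.
Unshelve. all: by end_near. Qed.

End Asymptotics.

Theorem proposition12 (R : realType) (abs : absQbar R) (N : nat)
    (phi : ratmap N) (P : proj_space N) :
  dominant phi ->
  (2 <= ratmap_deg phi)%N ->
  orbit_defined phi P ->
  (arithmetic_degree abs phi P <= (dynamical_degree R phi)%:E)%E.
Proof.
move=> phi_dom d2 Pphi.
have [delta1 delta_root] := @fekete_root R (iterate_deg phi)
  (fun n => iterate_deg_gt0 phi_dom n d2) (iterate_degD phi_dom).
(* When the heights vanish eventually, the conventional value 1 is at most the dynamical degree. *)
rewrite /arithmetic_degree; case: ifPn => [_|_]; first by rewrite lee_fin.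
set h := fun n : nat => weil_height abs (iter n (ratmap_apply phi) P).
apply/lee_addgt0Pr => e e0.
have [|m [m0 amr]] := delta_root (dynamical_degree R phi + e); first by rewrite ltrDl.
have [psi [psid psiP]] := coords_iterate phi_dom m.
have [C [C0 CP]] := weil_height_image abs (@ratmap_homogeneous _ psi).
set rho := (iterate_deg phi m)%:R `^ m%:R^-1 in amr.
have rho1 : 1 <= rho by apply: powR_inv_ge1; rewrite ler1n iterate_deg_gt0.
have [|n0 n0P] := @affine_growth R h m rho C (dynamical_degree R phi + e)
  m0 rho1 C0 _ amr.
  (* The height inequality for the reduced m-th iterate, at the n-th point of the orbit. *)
  move=> n; rewrite powR_invK // -psid /h addnC iterD.
  by apply: CP; apply: psiP; exact: orbit_defined_iter.
(* The threshold is at least 1 because the n-th root is only meaningful for positive [n]. *)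
rewrite -EFinD; apply: (@limn_esup_le_near _ _ _ (maxn n0 1)) => n.
rewrite geq_max lee_fin => /andP[nn0 n1].
apply: powR_inv_le => //; last exact: n0P.
by rewrite (le_trans delta1) // lerDl ltW.
Qed.
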